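(* Consider the budgeted linear contextual bandit problem with dimension $d$, noise parameter $\sigma$, and norm bounds $L,D>0$, and let $\lambda>0$ and $\delta\in(0,1)$. For any non-decreasing budgets and context sets $\{B(t),\mathcal X_t\}_{t\ge1}$ chosen by an adaptive adversary, where $B(1)>0$ is large enough that the query condition of CBM-OFUL holds at round $t=1$, with probability at least $1-\delta$ the regret of CBM-OFUL satisfies, for all $T\ge1$, $$\mathrm{Reg}(T)\le 2\,l_T\,v_T\left(\sum_{t=1}^T\frac{1}{\sqrt{B(t)}}+\sqrt T\right),$$ where $$l_t=\max\left\{1,\ \sigma\sqrt{2d\log\left(\frac{1+tL^2/\lambda}{\delta}\right)}+\lambda^{1/2}D\right\},\qquad v_t=\sqrt{2d\log\left(1+\frac{tL^2}{d\lambda}\right)} .$$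
   Context: Problem. At the beginning of each round $t$, an adaptive adversary (choosing as a function of the history before round $t$) reveals a budget $B(t)\ge B(t-1)$ and a context set $\mathcal X_t\subset\mathbb R^d$ with $\|x\|_2\le L$ for all $x\in\mathcal X_t$. The learner selects $x_t\in\mathcal X_t$ and may query ($q_t=1$, at unit cost) the reward $R_t=\langle x_t,\theta^*\rangle+\eta_t$, where $\theta^*\in\mathbb R^d$ is unknown with $\|\theta^*\|_2\le D$ and $\langle x,\theta^*\rangle\in[-1,1]$ for all $x\in\mathcal X_t$, $t\ge1$, and $\eta_t$ is zero-mean and conditionally $\sigma^2$-subgaussian given the history up to and including the choice of $x_t$ and $q_t$. If $q_t=0$ no reward is observed. The regret is $\mathrm{Reg}(T)=\sum_{t=1}^T\big(\max_{x\in\mathcal X_t}\langle x,\theta^*\rangle-\langle x_t,\theta^*\rangle\big)$. Notation. $\|x\|_M=\sqrt{x^{\top}Mx}$; $V_t=\lambda I_d+\sum_{k=1}^tx_kx_k^{\top}\mathbf 1\{q_k=1\}$; $\hat\theta_t=V_t^{-1}\sum_{k=1}^tx_kR_k\mathbf 1\{q_k=1\}$; $C_t=\{\theta\in\mathbb R^d:\|\hat\theta_t-\theta\|_{V_t}\le l_t\}$, with $l_t$ as in the claim; $v_b=\sqrt{2d\log(1+bL^2/(d\lambda))}$ for real $b\ge0$; $CI_t(x)=2l_{t-1}\min\{\|x\|_{V_{t-1}^{-1}},1\}$. CBM-OFUL. At each round $t$, observe $B(t)$ and $\mathcal X_t$, play $x_t\in\arg\max_{x\in\mathcal X_t}\max_{\theta\in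 C_{t-1}}\langle x,\theta\rangle$, and query the reward ($q_t=1$) if and only if $CI_t(x_t)\ge \dfrac{2\,l_{t-1}\,v_{B(t)}}{\sqrt{B(t)}}$. *)

(* Defs.v *)
From HB Require Import structures.
From mathcomp Require Import all_boot all_order all_algebra.
From mathcomp Require Import all_classical all_reals all_analysis.

Set Implicit Arguments.
Unset Strict Implicit.
Unset Printing Implicit Defensive.

Import Order.TTheory GRing.Theory Num.Theory.
Import numFieldNormedType.Exports.

Local Open Scope classical_set_scope.
Local Open Scope ring_scope.

Section Euclidean.
Context {R : realType} {d : nat}.
Implicit Types (x y : 'cV[R]_d) (M : 'M[R]_d).

Definition dotp x y : R := (x^T *m y) 0 0.

(* The library norm on matrices is the sup norm, so the Euclidean one is
   introduced here. *)
Definition norm2 x : R := Num.sqrt (dotp x x).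

Definition normM M x : R := Num.sqrt ((x^T *m M *m x) 0 0).

End Euclidean.

Definition argmax {T : Type} {R : realType} (A : set T) (f : T -> R) : set T :=
  [set x | A x /\ forall y, A y -> f y <= f x].

Section Probability.
Context {disp : measure_display} {Omega : measurableType disp} {R : realType}.
Variable P : probability Omega R.
Local Open Scope ereal_scope.

(* The sigma-algebra generated by a family of real-valued functions. *)
Definition sigma_generated (Fs : set (Omega -> R)) : set (set Omega) :=
  <<s [set A | exists2 f, Fs f &
                 exists2 S : set R, measurable S & A = f @^-1` S] >>.

(* Y is a version of E[Z | G]. *)
Definition is_cond_exp (G : set (set Omega)) (Z Y : Omega -> R) : Prop :=
  [/\ G `<=` measurable,
      P.-integrable setT (EFin \o Z),
      P.-integrable setT (EFin \o Y),
      (forall S : set R, measurable S -> G (Y @^-1` S)) &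
      forall A, G A -> \int[P]_(w in A) (Y w)%:E = \int[P]_(w in A) (Z w)%:E].

Definition cond_zero_mean (G : set (set Omega)) (Z : Omega -> R) : Prop :=
  is_cond_exp G Z (fun=> 0%R).

(* E[exp (s Z) | G] <= exp (s^2 sigma^2 / 2) a.s., for every real s. *)
Definition cond_subgaussian (G : set (set Omega)) (sigma : R)
    (Z : Omega -> R) : Prop :=
  forall s : R, exists2 Y : Omega -> R,
    is_cond_exp G (fun w => expR (s * Z w)) Y &
    {ae P, forall w, (Y w <= expR (s ^+ 2 * sigma ^+ 2 / 2))%R}.

(* The sets of outcomes considered below need not be measurable, because the
   context sets are arbitrary; S has probability at least p when it contains a
   measurable event of probability at least p (for measurable S this is just
   p <= P S). *)
Definition with_probability_at_least (p : R) (S : set Omega) : Prop :=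
  exists E, [/\ measurable E, E `<=` S & p%:E <= P E].

End Probability.

(* What is recorded of one round; the feedback is None when the reward was not
   queried. *)
Record round (R : realType) (d : nat) := Round {
  round_budget : R;
  round_contexts : set 'cV[R]_d;
  round_action : 'cV[R]_d;
  round_query : bool;
  round_feedback : option R }.

(* The random processes of the interaction.  Rounds are numbered 1, 2, ...;
   the values at index 0 are never used. *)
Record interaction (disp : measure_display) (Omega : measurableType disp)
    (R : realType) (P : probability Omega R) (d : nat) := Interaction {
  budget : nat -> {RV P >-> R};
  contexts : nat -> Omega -> set 'cV[R]_d;
  action : nat -> Omega -> 'cV[R]_d;
  query : nat -> {RV P >-> bool};
  noise : nat -> {RV P >-> R};
  measurable_action : forall t (i : 'I_d),
    measurable_fun setT (fun w => action t w i 0) }.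

Section Interaction.
Context {disp : measure_display} {Omega : measurableType disp} {R : realType}.
Context {P : probability Omega R} {d : nat}.
Variables (I : interaction P d) (theta : 'cV[R]_d).

Definition reward (t : nat) (w : Omega) : R :=
  dotp (action I t w) theta + noise I t w.

(* The history of the rounds 1, ..., t, in chronological order. *)
Definition history (t : nat) (w : Omega) : seq (round R d) :=
  [seq Round (budget I s w) (contexts I s w) (action I s w) (query I s w)
         (if query I s w then Some (reward s w) else None) | s <- iota 1 t].

(* The adversary's strategy maps the history before a round to the budget and
   the context set of that round. *)
Definition chosen_by_adversary
    (adv : seq (round R d) -> R * set 'cV[R]_d) : Prop :=
  forall t w, (budget I t.+1 w, contexts I t.+1 w) = adv (history t w).

(* The sigma-algebra of the history up to and including the choice of the
   action and of the query of round t.  The pair formed by q_s and q_s * R_s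
   carries the same information as the feedback of round s; the context sets
   are functions of the earlier history and are not listed as generators. *)
Definition history_sigma (t : nat) : set (set Omega) :=
  sigma_generated
    ([set f : Omega -> R | exists2 s : nat, (1 <= s <= t)%N & f = budget I s :> (Omega -> R)]
     `|` [set f : Omega -> R | exists2 s : nat, (1 <= s <= t)%N &
                    exists i : 'I_d, f = (fun w => action I s w i 0)]
     `|` [set f : Omega -> R | exists2 s : nat, (1 <= s <= t)%N &
                    f = (fun w => (query I s w)%:R)]
     `|` [set f : Omega -> R | exists2 s : nat, (1 <= s < t)%N &
                    f = (fun w => (query I s w)%:R * reward s w)]).

(* The maximum of <x, theta> over the (bounded, non-empty) context set is
   rendered by sup, its value whenever it is attained. *)
Definition regret (T : nat) (w : Omega) : R :=
  \sum_(1 <= t < T.+1)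
    (sup [set dotp x theta | x in contexts I t w] - dotp (action I t w) theta).

Section Algorithm.
Variables (lambda : R) (l : nat -> R) (v : R -> R).

Definition gram (t : nat) (w : Omega) : 'M[R]_d :=
  lambda%:M + \sum_(1 <= k < t.+1 | query I k w)
                 action I k w *m (action I k w)^T.

Definition estimate (t : nat) (w : Omega) : 'cV[R]_d :=
  invmx (gram t w) *m
    \sum_(1 <= k < t.+1 | query I k w) reward k w *: action I k w.

Definition confidence_set (t : nat) (w : Omega) : set 'cV[R]_d :=
  [set th | normM (gram t w) (estimate t w - th) <= l t].

(* Maximum of <x, theta> over the confidence ellipsoid, which is compact and,
   for l >= 0, non-empty. *)
Definition optimistic_value (t : nat) (w : Omega) (x : 'cV[R]_d) : R :=
  sup [set dotp x th | th in confidence_set t w].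

Definition confidence_width (t : nat) (w : Omega) (x : 'cV[R]_d) : R :=
  2 * l t.-1 * Num.min (normM (invmx (gram t.-1 w)) x) 1.

Definition query_condition (t : nat) (w : Omega) : bool :=
  2 * l t.-1 * v (budget I t w) / Num.sqrt (budget I t w)
    <= confidence_width t w (action I t w).

Definition follows_CBM_OFUL : Prop :=
  forall (t : nat) (w : Omega), (1 <= t)%N ->
    argmax (contexts I t w) (optimistic_value t.-1 w) (action I t w) /\
    query I t w = query_condition t w.

End Algorithm.
End Interaction.

Definition v_fun {R : realType} (d : nat) (L lambda b : R) : R :=
  Num.sqrt (2 * d%:R * ln (1 + b * L ^+ 2 / (d%:R * lambda))).

Definition l_fun {R : realType} (d : nat) (sigma L D lambda delta : R)
    (t : nat) : R :=
  Num.max 1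
    (sigma * Num.sqrt (2 * d%:R * ln ((1 + t%:R * L ^+ 2 / lambda) / delta))
     + Num.sqrt lambda * D).

(* Main.v *)
(* On the event that theta lies in every confidence ellipsoid, optimism bounds
   the regret of round t by 2 l_{t-1} a_t with a_t = min(|x_t|_{V_{t-1}^-1}, 1).

   Sum of the a_t.  With c = L^2 / (d lambda), the tangent of log at 1 + T c
   gives v_B <= v_T + kappa sqrt B for every B, where kappa^2 = 2 d c / (1 + T c).
   Hence an unqueried round has a_t <= v_T / sqrt B(t) + kappa, whether B(t) is
   below or above T.  The elliptical potential (det V bounded by Hadamard and
   AM-GM) bounds the sum of a_t^2 over the n queried rounds by v_n^2, and the
   same tangent gives v_n^2 + (T - n) kappa^2 <= v_T^2; Cauchy-Schwarz then
   yields the term v_T sqrt T.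

   Confidence.  Z_t = sqrt(lambda^d / det V_t) exp(|S_t|^2_{V_t^-1} / (2 sigma^2)),
   S_t being the sum of the queried x_k eta_k, is a supermartingale: one step
   integrates exp(m eta + s^2 eta^2 / 2) with m, s depending on the past, and
   writing this as a mixture of exp(u eta) over u ~ N(m, s^2) leaves only
   constant exponents u.  Ville's inequality concludes. *)
Require Import Defs.
From HB Require Import structures.
From mathcomp Require Import all_boot all_order all_algebra.
From mathcomp Require Import all_classical all_reals all_analysis.
From mathcomp Require Import measurable_realfun.
From mathcomp Require Import ring lra.

Set Implicit Arguments.
Unset Strict Implicit.
Unset Printing Implicit Defensive.

Import Order.TTheory GRing.Theory Num.Theory.
Import numFieldNormedType.Exports.

Local Open Scope classical_set_scope.
Local Open Scope ring_scope.

(** * Quadratic forms and determinants *)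

Section QuadraticForms.
Context {R : realFieldType}.

(** For [M] the identity this is the Euclidean inner product, so one calculus serves both [dotp] and
    the [V]-weighted norms. *)
Definition bform {d : nat} (M : 'M[R]_d) (x y : 'cV[R]_d) : R :=
  (x^T *m M *m y) 0 0.

(** Symmetry has to be imposed: over a real field, positivity of the quadratic form does not force
    it. *)
Definition posdef {d : nat} (M : 'M[R]_d) : Prop :=
  M^T = M /\ forall x, x != 0 -> 0 < bform M x x.

Section Fixed.
Context {d : nat}.
Implicit Types (M : 'M[R]_d) (x y z : 'cV[R]_d).

Lemma bformDl M x y z : bform M (x + y) z = bform M x z + bform M y z.
Proof. by rewrite /bform linearD /= !mulmxDl mxE. Qed.

Lemma bformDr M x y z : bform M z (x + y) = bform M z x + bform M z y.
Proof. by rewrite /bform mulmxDr mxE. Qed.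

Lemma bformZl M a x y : bform M (a *: x) y = a * bform M x y.
Proof. by rewrite /bform linearZ /= -!scalemxAl mxE. Qed.

Lemma bformZr M a x y : bform M x (a *: y) = a * bform M x y.
Proof. by rewrite /bform -scalemxAr mxE. Qed.

Lemma bform0r M x : bform M x 0 = 0.
Proof. by rewrite /bform mulmx0 mxE. Qed.

Lemma bform0l M x : bform M 0 x = 0.
Proof. by rewrite /bform trmx0 !mul0mx mxE. Qed.

Lemma bformDM M N x y : bform (M + N) x y = bform M x y + bform N x y.
Proof. by rewrite /bform mulmxDr mulmxDl mxE. Qed.

Lemma bformZM a M x y : bform (a *: M) x y = a * bform M x y.
Proof. by rewrite /bform -scalemxAr -scalemxAl mxE. Qed.

Lemma bformC M x y : M^T = M -> bform M x y = bform M y x.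
Proof.
move=> sM; rewrite /bform -[in LHS](trmxK (x^T *m M *m y)) mxE.
by rewrite !trmx_mul sM trmxK mulmxA.
Qed.

Lemma bform1 x y : bform 1%:M x y = (x^T *m y) 0 0.
Proof. by rewrite /bform mulmx1. Qed.

Lemma bform_rank1 x y z : bform (x *m x^T) y z = bform 1%:M x y * bform 1%:M x z.
Proof.
rewrite /bform !mulmx1 (mulmxA y^T) -(mulmxA (y^T *m x)) mxE big_ord1.
by rewrite -[y^T *m x]trmxK mxE trmx_mul trmxK.
Qed.

Lemma bform_mul M N x y : bform N (M *m x) y = bform (M^T *m N) x y.
Proof. by rewrite /bform trmx_mul !mulmxA. Qed.

Lemma bform_mulr M N x y : bform N x (M *m y) = bform (N *m M) x y.
Proof. by rewrite /bform !mulmxA. Qed.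

Lemma dot_sqr x : bform 1%:M x x = \sum_i x i 0 ^+ 2.
Proof. by rewrite bform1 mxE; apply: eq_bigr => i _; rewrite mxE expr2. Qed.

Lemma dot_ge0 x : 0 <= bform 1%:M x x.
Proof. by rewrite dot_sqr sumr_ge0 // => i _; rewrite sqr_ge0. Qed.

Lemma dot_gt0 x : x != 0 -> 0 < bform 1%:M x x.
Proof.
move=> x0; rewrite lt_def dot_ge0 andbT dot_sqr; apply: contra x0 => /eqP s0.
apply/eqP/matrixP => i j; rewrite !ord1 mxE; apply/eqP.
rewrite -sqrf_eq0; apply/eqP.
by apply: (psumr_eq0P _ s0) => // k _; rewrite sqr_ge0.
Qed.

Lemma posdef_ge0 M x : posdef M -> 0 <= bform M x x.
Proof.
by move=> [_ pM]; have [->|/pM/ltW//] := eqVneq x 0; rewrite bform0r.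
Qed.

(** A quadratic in [s] that is never negative has nonpositive discriminant: evaluate it at its
    minimizer [b / c]. Both [bform_CS] and [sum_CS] reduce to this. *)
Lemma quad_CS (a b c : R) : (forall s, 0 <= a - 2 * s * b + s ^+ 2 * c) ->
  0 <= c -> b ^+ 2 <= a * c.
Proof.
move=> h; rewrite le_eqVlt => /predU1P[c0|c_gt0].
  rewrite -c0 mulr0; have [->|b0] := eqVneq b 0; first by rewrite expr0n.
  (* At this [s] the affine function [a - 2 * s * b] equals -1. *)
  have := h ((a + 1) / (2 * b)); rewrite -c0 mulr0 addr0.
  have -> : 2 * ((a + 1) / (2 * b)) * b = a + 1 by field.
  lra.
have := h (b / c).
have -> : a - 2 * (b / c) * b + (b / c) ^+ 2 * c = (a * c - b ^+ 2) / c.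
  by field; rewrite gt_eqF.
by rewrite pmulr_lge0 ?invr_gt0// subr_ge0.
Qed.

Lemma bform_CS M x y : posdef M ->
  bform M x y ^+ 2 <= bform M x x * bform M y y.
Proof.
move=> pM; apply: quad_CS; last exact: posdef_ge0.
move=> s; have := posdef_ge0 (x + (- s) *: y) pM.
rewrite !(bformDl, bformDr, bformZl, bformZr) (bformC y x pM.1); lra.
Qed.

End Fixed.

Lemma posdef_scalar d (a : R) : 0 < a -> posdef (a%:M : 'M[R]_d).
Proof.
move=> a0; split=> [|x x0]; first by rewrite tr_scalar_mx.
rewrite /bform mul_mx_scalar -scalemxAl mxE mulr_gt0//.
by have := dot_gt0 x0; rewrite bform1.
Qed.

Lemma posdef_rank1 d (M : 'M[R]_d) (x : 'cV_d) : posdef M -> posdef (M + x *m x^T).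
Proof.
move=> [sM pM]; split=> [|y y0]; first by rewrite linearD /= sM trmx_mul trmxK.
by rewrite bformDM bform_rank1 -expr2 ltr_wpDr ?sqr_ge0 ?pM.
Qed.

(* By induction on d: the Schur complement of the upper left entry is again
   positive definite, and its diagonal entries are smaller. *)
Lemma posdef_det d (M : 'M[R]_d) :
  posdef M -> 0 < \det M <= \prod_i M i i.
Proof.
elim: d M => [|d IH] M [sM pM]; first by rewrite det_mx00 big_ord0 ltr01 lexx.
pose N : 'M[R]_(1 + d) := M.
pose a := M 0 0; pose b : 'cV[R]_d := dlsubmx N; pose D : 'M[R]_d := drsubmx N.
have NE : N = block_mx a%:M b^T b D.
  rewrite -[LHS]submxK -/b -/D; congr block_mx.
    by rewrite [LHS]mx11_scalar !mxE; congr (M _ _)%:M; apply/val_inj.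
  apply/matrixP => i j; rewrite !mxE -[in LHS](sM : N^T = N) mxE.
  by congr (N _ _).
have sD : D^T = D by rewrite /D trmx_drsub (sM : N^T = N).
have a0 : 0 < a.
  have := pM (delta_mx 0 0).
  rewrite /bform trmx_delta -rowE -colE !mxE; apply.
  by apply/eqP => /matrixP/(_ 0 0)/eqP; rewrite !mxE !eqxx oner_eq0.
pose S := D - a^-1 *: (b *m b^T).
have sS : S^T = S by rewrite /S linearB /= linearZ /= trmx_mul trmxK sD.
have pS : posdef S.
  (* This first coordinate minimizes the form of [M] over vectors with lower part [y]; the minimum
     is the form of [S] at [y]. *)
  split=> // y y0; pose c := - a^-1 * (b^T *m y) 0 0.
  have := pM (col_mx c%:M y).
  suff -> : bform M (col_mx c%:M y) (col_mx c%:M y) = bform S y y.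
    apply; apply: contra y0 => /eqP e.
    by rewrite -[y](@col_mxKd _ 1 _ _ c%:M) e linear0.
  rewrite -[LHS]/(bform N (col_mx c%:M y) (col_mx c%:M y)) NE /bform.
  rewrite tr_col_mx mul_row_block mul_row_col tr_scalar_mx /S.
  rewrite !mulmxDl !mulmxDr !mulmxDl.
  have yb : y^T *m b = ((b^T *m y) 0 0)%:M.
    by rewrite -[LHS]trmxK trmx_mul trmxK [in LHS](mx11_scalar (b^T *m y)) tr_scalar_mx.
  rewrite mulmxN mulNmx -scalemxAr -scalemxAl (mulmxA y^T b) yb.
  rewrite -!scalar_mxM !mul_scalar_mx -!scalemxAl.
  rewrite [b^T *m y]mx11_scalar -!scale_scalar_mx !mxE /= !mulr1n.
  by rewrite /c !mxE; field; rewrite gt_eqF.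
have detM : \det M = a * \det S.
  pose L : 'M[R]_(1 + d) := block_mx 1%:M 0 (- a^-1 *: b) 1%:M.
  have : L *m N = block_mx a%:M b^T 0 S.
    rewrite NE mulmx_block !mul1mx !mul0mx !addr0 -mul_scalar_mx.
    congr block_mx; rewrite mul_scalar_mx -!scalemxAl.
      rewrite mul_mx_scalar scalerA mulNr mulVf ?gt_eqF//.
      by rewrite scaleN1r addNr.
    by rewrite scaleNr addrC.
  move=> /(congr1 determinant); rewrite det_mulmx det_lblock !det1 !mul1r.
  by rewrite det_ublock det_scalar1.
have /andP[S0 Sle] := IH _ pS.
rewrite detM pmulr_lgt0 ?a0 ?S0//= big_ord_recl -/a ler_pM2l//.
apply: le_trans Sle _; apply: ler_prod => i _; apply/andP; split.
  have := pS.2 (delta_mx i 0); rewrite /bform trmx_delta -rowE -colE !mxE => h.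
  apply/ltW/h.
  by apply/eqP => /matrixP/(_ i 0)/eqP; rewrite !mxE !eqxx oner_eq0.
have -> : M (lift ord0 i) (lift ord0 i) = D i i.
  by rewrite /D !mxE; congr (M _ _); apply/val_inj.
rewrite /S !mxE big_ord1 !mxE -expr2 gerDl oppr_le0 mulr_ge0 ?sqr_ge0 //.
by rewrite invr_ge0 ltW.
Qed.

Lemma posdef_det_gt0 d (M : 'M[R]_d) : posdef M -> 0 < \det M.
Proof. by move=> /posdef_det/andP[]. Qed.

Lemma posdef_unit d (M : 'M[R]_d) : posdef M -> M \in unitmx.
Proof. by move=> /posdef_det_gt0 h; rewrite unitmxE unitfE gt_eqF. Qed.

Lemma posdef_diag_ge0 d (M : 'M[R]_d) i : posdef M -> 0 <= M i i.
Proof.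
move=> pM; have := posdef_ge0 (delta_mx i 0) pM.
by rewrite /bform trmx_delta -rowE -colE !mxE.
Qed.

Lemma posdef_det_trace d (M : 'M[R]_d) : posdef M ->
  \det M <= (\tr M / d%:R) ^+ d.
Proof.
move=> pM; have /andP[_ /le_trans] := posdef_det pM; apply.
have := @leif_AGM _ _ predT (fun i => M i i).
by rewrite card_ord => /(_ (fun i _ => posdef_diag_ge0 i pM))[+ _].
Qed.

Lemma posdef_inv d (M : 'M[R]_d) : posdef M -> posdef (invmx M).
Proof.
move=> pM; have uM := posdef_unit pM; split=> [|x x0].
  by rewrite trmx_inv pM.1.
have -> : bform (invmx M) x x = bform M (invmx M *m x) (invmx M *m x).
  by rewrite bform_mul bform_mulr trmx_inv pM.1 mulVmx// mul1mx.
apply: pM.2; apply: contra x0 => /eqP e.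
by rewrite -[x](mulKVmx uM) e mulmx0.
Qed.

(** Cauchy-Schwarz for the form of [M], applied to [invmx M *m x] and [y]. *)
Lemma bform_inv_CS d (M : 'M[R]_d) x y : posdef M ->
  bform 1%:M x y ^+ 2 <= bform (invmx M) x x * bform M y y.
Proof.
move=> pM; have uM := posdef_unit pM.
have := bform_CS (invmx M *m x) y pM.
by rewrite !bform_mul trmx_inv pM.1 mulVmx// bform_mulr mul1mx.
Qed.

(** The block matrix [K] is brought to triangular form by two unipotent factors, one clearing each
    off-diagonal block; the two resulting values of [\det K] agree. *)
Lemma det_add_rank1 d (u : 'cV[R]_d) (v : 'rV[R]_d) :
  \det (1%:M + u *m v) = 1 + (v *m u) 0 0.
Proof.
pose K : 'M[R]_(1 + d) := block_mx 1%:M (- v) u 1%:M.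
have h1 : \det K = \det (1%:M + u *m v).
  have : K *m block_mx 1%:M v 0 1%:M = block_mx 1%:M 0 u (1%:M + u *m v).
    rewrite mulmx_block !mul1mx !mulmx1 !mulmx0 !addr0 addrN.
    by rewrite addrC.
  move=> /(congr1 determinant); rewrite det_mulmx det_ublock det_lblock.
  by rewrite !det1 !mulr1 mul1r.
rewrite -h1; have : K *m block_mx 1%:M 0 (- u) 1%:M
    = block_mx (1%:M + v *m u) (- v) 0 1%:M.
  rewrite mulmx_block !mul1mx !mulmx1 !mulmx0 !add0r addrN.
  by rewrite mulNmx mulmxN opprK.
move=> /(congr1 determinant); rewrite det_mulmx det_ublock det_lblock.
by rewrite !det1 !mulr1 det_mx11 !mxE eqxx.
Qed.

Section RankOneUpdate.
Context {d : nat} (M : 'M[R]_d) (x : 'cV[R]_d).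
Hypothesis pM : posdef M.
Let U := invmx M.
Let w := bform U x x.

Lemma det_rank1 : \det (M + x *m x^T) = \det M * (1 + w).
Proof.
have uM := posdef_unit pM.
have -> : M + x *m x^T = M *m (1%:M + (U *m x) *m x^T).
  by rewrite mulmxDr mulmx1 !mulmxA mulmxV// mul1mx.
by rewrite det_mulmx det_add_rank1 mulmxA.
Qed.

(** The Sherman-Morrison formula, checked by multiplying both sides by [M + x *m x^T]. *)
Lemma inv_rank1 : invmx (M + x *m x^T) =
  U - (1 + w)^-1 *: (U *m x *m (x^T *m U)).
Proof.
have uM := posdef_unit pM.
have w0 : 0 <= w by apply: posdef_ge0; exact: posdef_inv.
have uM' := posdef_unit (posdef_rank1 x pM).
apply: (can_inj (mulKmx uM')); rewrite mulmxV// mulmxBr -scalemxAr.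
rewrite !mulmxDl mulmxV// !mulmxA mulmxV// mul1mx.
have -> : x *m x^T *m U *m x *m x^T *m U = w *: (x *m x^T *m U).
  rewrite -(mulmxA x x^T U) -(mulmxA x _ x) [x^T *m U *m x]mx11_scalar.
  by rewrite mul_mx_scalar -!scalemxAl mulmxA.
rewrite -[X in X + w *: _]scale1r -scalerDl scalerA mulVf ?scale1r ?addrK//.
by rewrite gt_eqF// ltr_wpDr.
Qed.

(** Written as a polynomial in [e], which will be the new noise: its linear and quadratic
    coefficients become the mean and variance of the Gaussian mixture in the supermartingale
    step. *)
Lemma bform_inv_rank1 s e :
  bform (invmx (M + x *m x^T)) (s + e *: x) (s + e *: x) =
  bform U s s - bform U x s ^+ 2 / (1 + w)
  + 2 * (bform U x s / (1 + w)) * e + w / (1 + w) * e ^+ 2.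
Proof.
have w0 : 0 <= w by apply: posdef_ge0; exact: posdef_inv.
have sU : U^T = U by apply: (posdef_inv pM).1.
have key y : bform (invmx (M + x *m x^T)) y y =
    bform U y y - bform U x y ^+ 2 / (1 + w).
  rewrite inv_rank1; have -> : x^T *m U = (U *m x)^T by rewrite trmx_mul sU.
  by rewrite -scaleNr bformDM bformZM bform_rank1 bform_mul mulmx1 sU; ring.
rewrite key !(bformDl, bformDr, bformZl, bformZr) (bformC s x sU) -/w.
by field; rewrite gt_eqF// ltr_wpDr.
Qed.
End RankOneUpdate.

End QuadraticForms.

(** * Elliptical potential and the budget sum *)

Lemma sum_CS {R : realFieldType} (r : seq nat) (a b : nat -> R) :
  (\sum_(i <- r) a i * b i) ^+ 2 <=
  (\sum_(i <- r) a i ^+ 2) * (\sum_(i <- r) b i ^+ 2).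
Proof.
apply: quad_CS; last by apply: sumr_ge0 => i _; rewrite sqr_ge0.
move=> s; suff -> : \sum_(i <- r) a i ^+ 2 - 2 * s * (\sum_(i <- r) a i * b i)
    + s ^+ 2 * (\sum_(i <- r) b i ^+ 2) = \sum_(i <- r) (a i - s * b i) ^+ 2.
  by apply: sumr_ge0 => i _; rewrite sqr_ge0.
rewrite !mulr_sumr -sumrB -big_split /=; apply: eq_bigr => i _; ring.
Qed.

Section Logarithm.
Context {R : realType}.
Implicit Types x y z : R.

(** Concavity, reduced to [ln (1 + u) <= u] at [u = (y - z) / z]. *)
Lemma ln_tangent y z : 0 < y -> 0 < z -> ln y <= ln z + (y - z) / z.
Proof.
move=> y0 z0; rewrite -lerBlDl -ln_div//.
have -> : y / z = 1 + (y - z) / z by field; rewrite gt_eqF.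
apply: le_ln1Dx; have := divr_gt0 y0 z0.
by rewrite mulrBl divff ?gt_eqF//; lra.
Qed.

Lemma ln_ge_tangent x : 0 < x -> 1 - x^-1 <= ln x.
Proof.
move=> x0; have := @ln_tangent x^-1 1; rewrite invr_gt0 x0 ltr01 => /(_ isT isT).
by rewrite ln1 add0r divr1 lnV// lerNl opprB.
Qed.

(** Through [1 - (1 + x)^-1 <= ln (1 + x)]: twice the left side is [2 * x / (1 + x)], which is at
    least [x] for [x <= 1] and at least 1 for [x > 1]. *)
Lemma min1_le_ln x : 0 <= x -> Num.min x 1 <= 2 * ln (1 + x).
Proof.
move=> x0; have h := @ln_ge_tangent (1 + x) ltac:(lra).
have [x1|x1] := leP x 1.
  apply: le_trans (_ : 2 * (1 - (1 + x)^-1) <= _); last by rewrite ler_pM2l.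
  have -> : 2 * (1 - (1 + x)^-1) = 2 * x / (1 + x) by field; lra.
  by rewrite ler_pdivlMr; nra.
apply: le_trans (_ : 2 * (1 - (1 + x)^-1) <= _); last by rewrite ler_pM2l.
suff : (1 + x)^-1 <= 2^-1 by lra.
by rewrite lef_pV2 ?posrE; lra.
Qed.

End Logarithm.

Section EllipticalPotential.
Context {R : realType} {d : nat} (lambda : R).
Implicit Types (x : nat -> 'cV[R]_d).

(** Every index contributes; unqueried rounds will be entered as zero vectors, so no query indicator
    appears in the linear algebra. *)
Definition design x (n : nat) : 'M[R]_d :=
  lambda%:M + \sum_(1 <= k < n.+1) x k *m (x k)^T.

Lemma design0 x : design x 0 = lambda%:M.
Proof. by rewrite /design big_geq// addr0. Qed.

Lemma designS x n : design x n.+1 = design x n + x n.+1 *m (x n.+1)^T.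
Proof. by rewrite /design [in LHS]big_nat_recr//= addrA. Qed.

Hypothesis lambda_gt0 : 0 < lambda.

Lemma posdef_design x n : posdef (design x n).
Proof.
elim: n => [|n IH]; first by rewrite design0; exact: posdef_scalar.
by rewrite designS; exact: posdef_rank1.
Qed.

Lemma design_ge_scalar x n y : lambda * bform 1%:M y y <= bform (design x n) y y.
Proof.
elim: n => [|n IH].
  by rewrite design0 -bformZM scale_scalar_mx mulr1.
by rewrite designS bformDM bform_rank1 -expr2 ler_wpDr// sqr_ge0.
Qed.

(** With [z = invmx V *m y], the quantity [q] is both the form of [V] at [z] and the inner product
    of [y] and [z]. Hence [q ^+ 2] is at most [N] times the squared norm of [z], which is at most
    [q / lambda]; one factor [q] cancels. *)
Lemma design_inv_le x n y :
  bform (invmx (design x n)) y y <= bform 1%:M y y / lambda.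
Proof.
have pV := posdef_design x n; have uV := posdef_unit pV.
set V := design x n in pV uV *; set q := bform _ _ _; set N := bform 1%:M y y.
pose z := invmx V *m y.
have q0 : 0 <= q by apply: posdef_ge0; exact: posdef_inv.
have N0 : 0 <= N by exact: dot_ge0.
have qE : q = bform V z z.
  by rewrite /z bform_mul bform_mulr trmx_inv pV.1 mulVmx// mul1mx.
have qE' : q = bform 1%:M y z by rewrite /z bform_mulr mul1mx.
have h1 : lambda * bform 1%:M z z <= q by rewrite qE; exact: design_ge_scalar.
have h2 : q ^+ 2 <= N * bform 1%:M z z.
  by rewrite qE'; apply: bform_CS; exact: posdef_scalar.
rewrite ler_pdivlMr//; have [->|qn0] := eqVneq q 0; first by rewrite mul0r.
have qp : 0 < q by rewrite lt_def qn0.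
rewrite -(ler_pM2l qp) mulrA -expr2.
have := ler_wpM2r (ltW lambda_gt0) h2; have := ler_wpM2l N0 h1; lra.
Qed.

Lemma design_trace x n :
  \tr (design x n) = lambda * d%:R + \sum_(1 <= k < n.+1) bform 1%:M (x k) (x k).
Proof.
rewrite /design linearD /= mxtrace_scalar mulr_natr; congr (_ + _).
rewrite linear_sum /=; apply: eq_bigr => k _.
by rewrite mxtrace_mulC /mxtrace big_ord1 bform1.
Qed.

Definition log_det_ratio x n : R := ln (\det (design x n) / lambda ^+ d).

Lemma det_ratio_gt0 x n : 0 < \det (design x n) / lambda ^+ d.
Proof. by rewrite divr_gt0 ?exprn_gt0// posdef_det_gt0//; exact: posdef_design. Qed.

Lemma log_det_ratio0 x : log_det_ratio x 0 = 0.
Proof. by rewrite /log_det_ratio design0 det_scalar divff ?ln1// gt_eqF ?exprn_gt0. Qed.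

Lemma log_det_ratioS x n : log_det_ratio x n.+1 = log_det_ratio x n
  + ln (1 + bform (invmx (design x n)) (x n.+1) (x n.+1)).
Proof.
have pV := posdef_design x n.
rewrite /log_det_ratio designS det_rank1// mulrAC lnM// posrE.
  exact: det_ratio_gt0.
by rewrite ltr_wpDr//; apply: posdef_ge0; exact: posdef_inv.
Qed.

(** The determinant is at most the [d]-th power of the mean eigenvalue, and the trace grows by the
    squared norm of each added vector. *)
Lemma log_det_ratio_le x n : (0 < d)%N -> log_det_ratio x n <=
  d%:R * ln (1 + (\sum_(1 <= k < n.+1) bform 1%:M (x k) (x k)) / (d%:R * lambda)).
Proof.
move=> d0; have dp : 0 < d%:R :> R by rewrite ltr0n.
set s := \sum_(_ <= _ < _) _.
have s0 : 0 <= s by apply: sumr_ge0 => k _; exact: dot_ge0.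
have y0 : 0 < 1 + s / (d%:R * lambda).
  by rewrite ltr_wpDr// divr_ge0// mulr_ge0 ?ltW.
rewrite mulr_natl -lnXn// ler_ln ?posrE ?det_ratio_gt0 ?exprn_gt0//.
rewrite ler_pdivrMr ?exprn_gt0// -exprMn.
apply: le_trans (posdef_det_trace (posdef_design x n)) _.
rewrite design_trace -/s le_eqVlt; apply/orP; left; apply/eqP; congr (_ ^+ _).
by field; rewrite !gt_eqF.
Qed.

Lemma log_det_ratio_ge0 x n : 0 <= log_det_ratio x n.
Proof.
elim: n => [|n IH]; first by rewrite log_det_ratio0.
rewrite log_det_ratioS addr_ge0// ln_ge0// lerDl; apply: posdef_ge0.
exact/posdef_inv/posdef_design.
Qed.

(** The logarithms [ln (1 + q)] telescope to [log_det_ratio], and [min1_le_ln] compares each summand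
    with its logarithm. *)
Lemma elliptical_potential x n :
  \sum_(1 <= k < n.+1)
    Num.min (bform (invmx (design x k.-1)) (x k) (x k)) 1 <= 2 * log_det_ratio x n.
Proof.
elim: n => [|n IH]; first by rewrite big_geq// log_det_ratio0 mulr0.
rewrite big_nat_recr//= log_det_ratioS mulrDr lerD// min1_le_ln//.
apply: posdef_ge0; exact/posdef_inv/posdef_design.
Qed.

End EllipticalPotential.

Section BudgetedSum.
Context {R : realType} (k c : R).
Hypotheses (k_ge0 : 0 <= k) (c_gt0 : 0 < c).
Let v (b : R) : R := Num.sqrt (k * ln (1 + b * c)).

Lemma sqr_sqrt_ln b : 0 <= b -> v b ^+ 2 = k * ln (1 + b * c).
Proof.
by move=> b0; rewrite sqr_sqrtr// mulr_ge0// ln_ge0// lerDl mulr_ge0// ltW.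
Qed.

(* The tangent of the logarithm at 1 + T c bounds v below and above T: an
   unqueried round costs at most v T / sqrt (B t) + kappa, and kappa ^ 2 is the
   rate at which v ^ 2 grows at T, so that m rounds of cost kappa and n = T - m
   queried rounds still fit in v T ^ 2. *)
Lemma budgeted_sum (T : nat) (q : pred nat) (a B : nat -> R) :
  (forall t, (1 <= t <= T)%N -> 0 < B t) ->
  (forall t, (1 <= t <= T)%N -> ~~ q t -> a t <= v (B t) / Num.sqrt (B t)) ->
  \sum_(1 <= t < T.+1 | q t) a t ^+ 2 <=
    v (\sum_(1 <= t < T.+1 | q t) 1) ^+ 2 ->
  \sum_(1 <= t < T.+1) a t <=
    v T%:R * (\sum_(1 <= t < T.+1) (Num.sqrt (B t))^-1 + Num.sqrt T%:R).
Proof.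
move=> B0 aB; set n : R := \sum_(1 <= t < T.+1 | q t) 1 => qa.
have v0 b : 0 <= v b by rewrite sqrtr_ge0.
have T0 : 0 <= T%:R :> R by [].
have n0 : 0 <= n by rewrite /n sumr_ge0.
pose z := 1 + T%:R * c; have z0 : 0 < z by rewrite ltr_wpDr ?mulr_ge0// ltW.
pose kappa := Num.sqrt (k * c / z).
have kappa0 : 0 <= kappa by rewrite sqrtr_ge0.
have kappa2 : kappa ^+ 2 = k * c / z by rewrite sqr_sqrtr// divr_ge0 ?mulr_ge0// ltW.
have tangent b : 0 <= b -> v b ^+ 2 + (T%:R - b) * kappa ^+ 2 <= v T%:R ^+ 2.
  move=> b0; rewrite !sqr_sqrt_ln// kappa2 -/z.
  have -> : (T%:R - b) * (k * c / z) = k * ((z - (1 + b * c)) / z).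
    by rewrite /z; field; rewrite gt_eqF.
  rewrite -mulrDr ler_wpM2l//.
  have b1 : 0 < 1 + b * c by rewrite ltr_wpDr ?mulr_ge0// ltW.
  have := ln_tangent b1 z0.
  by rewrite -(opprB z) mulNr; lra.
(* The part of round [t] that is not charged to its budget term. *)
pose e t := if q t then a t else kappa.
have ae t : (1 <= t <= T)%N -> a t <= v T%:R * (Num.sqrt (B t))^-1 + e t.
  move=> tT; have Bt := B0 _ tT.
  have sB : 0 < Num.sqrt (B t) by rewrite sqrtr_gt0.
  rewrite /e; case: ifPn => [_|/(aB _ tT)/le_trans]; first by rewrite lerDr divr_ge0// ltW.
  apply; rewrite ler_pdivrMr// mulrDl mulfVK ?gt_eqF//.
  (* What remains is [v (B t) <= v T%:R + kappa * Num.sqrt (B t)]. After squaring, [tangent]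
     suffices, because the cross term and [T%:R * kappa ^+ 2] are nonnegative. *)
  rewrite -(@ler_pXn2r _ 2)// ?nnegrE ?addr_ge0 ?mulr_ge0// ?sqrtr_ge0//.
  have := tangent (B t) (ltW Bt).
  have := sqr_sqrtr (ltW Bt).
  move: (v0 T%:R) sB kappa0; set s := Num.sqrt _ => vT s0 k0 s2 h.
  rewrite sqrrD; have : 0 <= v T%:R * (kappa * s) by rewrite !mulr_ge0 // ltW.
  have : (kappa * s) ^+ 2 = kappa ^+ 2 * B t by rewrite exprMn s2.
  have : 0 <= T%:R * kappa ^+ 2 by rewrite mulr_ge0// sqr_ge0.
  lra.
have e2 : \sum_(1 <= t < T.+1) e t ^+ 2 <= v T%:R ^+ 2.
  (* Here the tangent is used at [b = n], the number of queries: [T%:R - n] counts the rounds of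
     cost [kappa]. *)
  apply: le_trans (tangent n n0).
  have -> : \sum_(1 <= t < T.+1) e t ^+ 2 =
      \sum_(1 <= t < T.+1 | q t) a t ^+ 2 + \sum_(1 <= t < T.+1 | ~~ q t) kappa ^+ 2.
    rewrite (bigID q) /=; congr (_ + _); apply: eq_bigr => t; rewrite /e.
      by move=> ->.
    by move=> /negPf ->.
  apply: lerD => //; rewrite le_eqVlt; apply/orP; left; apply/eqP.
  have -> : T%:R = n + \sum_(1 <= t < T.+1 | ~~ q t) 1.
    have -> : T%:R = \sum_(1 <= t < T.+1) 1 :> R.
      by rewrite big_const_nat subn1 /= iter_addr_0.
    by rewrite (bigID q).
  by rewrite addrC addKr mulr_suml; apply: eq_bigr => t _; rewrite mul1r.
have e1 : \sum_(1 <= t < T.+1) e t <= v T%:R * Num.sqrt T%:R.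
  apply: le_trans (ler_norm _) _; rewrite -(@ler_pXn2r _ 2)// ?nnegrE ?mulr_ge0 ?sqrtr_ge0//.
  rewrite real_normK ?num_real// exprMn (sqr_sqrtr T0).
  have := sum_CS (index_iota 1 T.+1) e (fun=> 1).
  under eq_bigr do rewrite mulr1.
  move/le_trans; apply; apply: ler_pM => //.
  - by apply: sumr_ge0 => i _; rewrite sqr_ge0.
  - by apply: sumr_ge0 => i _; rewrite sqr_ge0.
  - by under eq_bigr do rewrite expr1n; rewrite big_const_nat subn1 /= iter_addr_0.
rewrite mulrDr; apply: le_trans (_ : \sum_(1 <= t < T.+1) (v T%:R * (Num.sqrt (B t))^-1 + e t) <= _).
  by rewrite !big_nat; apply: ler_sum => t tT; exact: ae.
by rewrite big_split /= -mulr_sumr lerD2l.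
Qed.

End BudgetedSum.

(** * Weighted integrals over a sub-sigma-algebra *)

Section SubSigmaAlgebra.
Context {disp : measure_display} {Omega : measurableType disp} {R : realType}.
Context (P : {measure set Omega -> \bar R}) (gs : set (set Omega)).
Hypothesis sub_gs : <<s gs>> `<=` @measurable _ Omega.

Local Notation OmegaG := (g_sigma_algebraType gs).

Lemma measurable_sub_id : measurable_fun setT (id : Omega -> OmegaG).
Proof. by move=> _ A mA; rewrite setTI; exact: sub_gs. Qed.

Lemma measurable_fun_sub d (T : measurableType d) (f : OmegaG -> T) :
  measurable_fun setT f -> measurable_fun setT (f : Omega -> T).
Proof. by move=> mf; exact: (measurableT_comp mf measurable_sub_id). Qed.

Import HBNNSimple.
Local Open Scope ereal_scope.

(** Takes the place of pulling a factor known from the past out of a conditional expectation: the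
    bound on events of the sub-sigma-algebra extends to nonnegative simple weights by linearity,
    then to [W] by monotone convergence. *)
Lemma weighted_integral_le (f : Omega -> R) (K : R) (W : OmegaG -> R) :
  measurable_fun setT f -> (forall w, 0 <= f w)%R -> (0 <= K)%R ->
  (forall A, <<s gs>> A -> \int[P]_(w in A) (f w)%:E <= K%:E * P A) ->
  measurable_fun setT W -> (forall w, 0 <= W w)%R ->
  \int[P]_w (W w * f w)%:E <= K%:E * \int[P]_w (W w)%:E.
Proof.
move=> mf f0 K0 fA mW W0.
have mEW : measurable_fun setT (EFin \o W) by exact/measurable_EFinP.
pose g := nnsfun_approx (@measurableT _ OmegaG) mEW.
have mg n : measurable_fun setT (g n : Omega -> R).
  by apply: measurable_fun_sub; exact: measurable_funP.
have ndg (w : Omega) : {homo (fun n => g n w) : m n / (m <= n)%N >-> (m <= n)%R}.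
  by move=> m n mn; have /lefP := nd_nnsfun_approx (@measurableT _ OmegaG) mEW mn; exact.
have cg w : EFin \o g^~ w @ \oo --> (W w)%:E.
  by apply: cvg_nnsfun_approx => // w' _; rewrite lee_fin.
have mfibG n (r : R) : <<s gs>> (g n @^-1` [set r]).
  exact: (@measurable_funPTI _ _ OmegaG _ (g n) [set r]).
have mfib n (r : R) : measurable (g n @^-1` [set r] : set Omega).
  exact: sub_gs.
have step n : \int[P]_w (g n w * f w)%:E <= K%:E * \int[P]_w (W w)%:E.
  apply: (@le_trans _ _ (K%:E * \int[P]_w (g n w)%:E)); last first.
    apply: lee_wpmul2l; rewrite ?lee_fin//.
    apply: ge0_le_integral => //.
    - by move=> w _; rewrite lee_fin.
    - by apply/measurable_EFinP; exact: mg.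
    - by apply/measurable_EFinP; exact: measurable_fun_sub.
    - move=> w _; rewrite -(cvg_lim _ (cg w))//; apply: lime_ge.
        by apply: ereal_nondecreasing_is_cvgn => i j ij; rewrite lee_fin ndg.
      by exists n => // m nm; rewrite lee_fin; exact: ndg.
  (* A simple weight is a finite sum over its values; its fibres lie in the sub-sigma-algebra, so
     the hypothesis applies to each. *)
  have -> : \int[P]_w (g n w * f w)%:E = \sum_(r \in range (g n))
      r%:E * \int[P]_(w in g n @^-1` [set r]) (f w)%:E.
    transitivity (\int[P]_w \sum_(r \in range (g n))
        (r * (\1_(g n @^-1` [set r]) w * f w))%:E).
      apply: eq_integral => w _; rewrite EFinM fimfunE -fsumEFin//.
      rewrite ge0_mule_fsuml//; last by move=> r; rewrite nnfun_muleindic_ge0.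
      by apply: eq_fsbigr => r _; rewrite -EFinM mulrA.
    rewrite ge0_integral_fsum//; last 2 first.
    - move=> r; apply/measurable_EFinP; apply: measurable_funM => //.
      by apply: measurable_funM => //; exact: measurable_indic.
    - move=> r w _; rewrite mulrA EFinM mule_ge0// ?lee_fin//.
      by rewrite -lee_fin nnfun_muleindic_ge0.
    apply: eq_fsbigr => r; rewrite inE => -[w0 _ rE].
    have r0 : (0 <= r)%R by rewrite -rE.
    under eq_integral do rewrite EFinM.
    rewrite ge0_integralZl_EFin//; last 2 first.
    - by move=> w _; rewrite lee_fin mulr_ge0.
    - by apply/measurable_EFinP; apply: measurable_funM.
    congr (_ * _); rewrite [RHS]integral_mkcond; apply: eq_integral => w _.
    by rewrite patchE indicE; case: ifPn => _; rewrite ?mul1r ?mul0r.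
  have -> : \int[P]_w (g n w)%:E = \sum_(r \in range (g n))
      r%:E * P (g n @^-1` [set r]).
    transitivity (\int[P]_w \sum_(r \in range (g n))
        (r * \1_(g n @^-1` [set r]) w)%:E).
      by apply: eq_integral => w _; rewrite fimfunE -fsumEFin.
    rewrite ge0_integral_fsum//; last 2 first.
    - move=> r; apply/measurable_EFinP; apply: measurable_funM => //.
    - by move=> r w _; rewrite nnfun_muleindic_ge0.
    apply: eq_fsbigr => r; rewrite inE => -[w0 _ rE].
    have r0 : (0 <= r)%R by rewrite -rE.
    under eq_integral do rewrite EFinM.
    rewrite ge0_integralZl_EFin//; last by apply/measurable_EFinP.
    by rewrite integral_indic// setIT.
  rewrite !fsbig_finite//= ge0_sume_distrr; last first.
    move=> r _; apply: (@mulemu_ge0 _ Omega _ P r (fun r => g n @^-1` [set r])) => r0.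
    exact: (@preimage_nnfun0 OmegaG).
  rewrite big_seq [leRHS]big_seq; apply: lee_sum => r.
  rewrite in_fset_set// inE => -[w0 _ <-].
  rewrite muleCA; apply: lee_wpmul2l; rewrite ?lee_fin//; exact: fA.
have -> : \int[P]_w (W w * f w)%:E = limn (fun n => \int[P]_w (g n w * f w)%:E).
  rewrite -monotone_convergence//.
  - apply: eq_integral => w _; apply/esym/cvg_lim => //.
    under eq_fun do rewrite EFinM; rewrite EFinM.
    by apply: cvgeM; [|exact: cg|exact: cvg_cst].
  - move=> n; apply/measurable_EFinP; apply: measurable_funM => //.
  - by move=> n w _; rewrite lee_fin mulr_ge0.
  - by move=> w _ m n mn; rewrite lee_fin ler_wpM2r// ndg.
apply: lime_le; last exact: nearW.
apply: ereal_nondecreasing_is_cvgn => m n mn; apply: ge0_le_integral => //.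
- by move=> w _; rewrite lee_fin mulr_ge0.
- by apply/measurable_EFinP; apply: measurable_funM.
- by apply/measurable_EFinP; apply: measurable_funM.
- by move=> w _; rewrite lee_fin ler_wpM2r// ndg.
Qed.

End SubSigmaAlgebra.

(** * Gaussian mixtures *)

Section MeasurableRealFunctions.
Context {d : measure_display} {T : measurableType d} {R : realType}.

Lemma measurable_funV_gt0 (f : T -> R) :
  (forall x, 0 < f x) -> measurable_fun setT f ->
  measurable_fun setT (fun x => (f x)^-1).
Proof.
move=> f0 mf; have -> : (fun x => (f x)^-1) = (fun x => expR (- ln (f x))).
  by apply/funext => x; rewrite expRN lnK ?posrE.
apply: (measurableT_comp (@measurable_expR R)); apply: measurable_funN.
exact: (measurableT_comp (@measurable_ln R)).
Qed.

Lemma measurable_fun_sqrt (f : T -> R) :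
  measurable_fun setT f -> measurable_fun setT (fun x => Num.sqrt (f x)).
Proof.
move=> mf; apply: (measurableT_comp _ mf).
by apply: continuous_measurable_fun; exact: sqrt_continuous.
Qed.

End MeasurableRealFunctions.

Section GaussianIntegrals.
Context {R : realType}.
Local Notation mu := (@lebesgue_measure R).
Implicit Types m s u x sigma : R.

Lemma normal_pdf_expR m s : s != 0 -> forall x, normal_pdf m s x =
  (Num.sqrt (s ^+ 2 * pi *+ 2))^-1 * expR (- (x - m) ^+ 2 / (s ^+ 2 *+ 2)).
Proof. by move=> s0 x; rewrite normal_pdfE. Qed.

Lemma integral_normal_scaled m s (k : R) : 0 <= k ->
  (\int[mu]_x (k * normal_pdf m s x)%:E = k%:E)%E.
Proof.
move=> k0; under eq_integral do rewrite EFinM.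
rewrite ge0_integralZl_EFin//.
- by rewrite integral_normal_pdf mule1.
- by move=> x _; rewrite lee_fin normal_pdf_ge0.
- by apply/measurable_EFinP; exact: measurable_normal_pdf.
Qed.

(** Completing the square turns the integrand into a constant times the normal density with mean
    [m + s ^+ 2 * u] and the same deviation. *)
Lemma integral_normal_expR m s u : s != 0 ->
  (\int[mu]_x (normal_pdf m s x * expR (x * u))%:E =
   (expR (m * u + s ^+ 2 * u ^+ 2 / 2))%:E)%E.
Proof.
move=> s0; rewrite -(@integral_normal_scaled (m + s ^+ 2 * u) s) ?expR_ge0//.
apply: eq_integral => x _; congr EFin.
rewrite !normal_pdf_expR// -[LHS]mulrA -expRD [RHS]mulrCA -expRD; congr (_ * expR _).
by field.
Qed.

(** Again by completing the square: the tilted density is normal with mean [m / t2] and deviation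
    [s / t], where [t2 = 1 - s ^+ 2 * sigma ^+ 2] must be positive for the integral to converge. *)
Lemma integral_normal_expR_sqr m s sigma : s != 0 -> s ^+ 2 * sigma ^+ 2 < 1 ->
  (\int[mu]_x (normal_pdf m s x * expR (x ^+ 2 * sigma ^+ 2 / 2))%:E =
   ((Num.sqrt (1 - s ^+ 2 * sigma ^+ 2))^-1 *
    expR (m ^+ 2 * sigma ^+ 2 / (2 * (1 - s ^+ 2 * sigma ^+ 2))))%:E)%E.
Proof.
move=> s0 ssig; set t2 := 1 - _.
have t20 : 0 < t2 by rewrite subr_gt0.
set t := Num.sqrt t2; have t0 : 0 < t by rewrite sqrtr_gt0.
have tE : t ^+ 2 = t2 by rewrite sqr_sqrtr// ltW.
rewrite -(@integral_normal_scaled (m / t2) (s / t)); last first.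
  by rewrite mulr_ge0 ?expR_ge0// invr_ge0 ltW.
apply: eq_integral => x _; congr EFin.
have st0 : s / t != 0 by rewrite mulf_neq0// invr_neq0// gt_eqF.
rewrite !normal_pdf_expR// -[LHS]mulrA -expRD.
rewrite [RHS]mulrACA -[in RHS]expRD; congr (_ * expR _).
  have -> : (s / t) ^+ 2 * pi *+ 2 = s ^+ 2 * pi *+ 2 * t^-1 ^+ 2.
    by rewrite expr_div_n exprVn mulrAC mulrnAl.
  rewrite sqrtrM; last by rewrite mulrn_wge0// mulr_ge0 ?sqr_ge0 ?pi_ge0.
  rewrite sqrtr_sqr gtr0_norm ?invr_gt0// invfM invrK mulrCA mulVf ?mulr1//.
  by rewrite gt_eqF.
rewrite expr_div_n tE; have : t2 = 1 - s ^+ 2 * sigma ^+ 2 by [].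
move=> e; have t2n : t2 != 0 by rewrite gt_eqF.
have -> : sigma ^+ 2 = (1 - t2) / s ^+ 2 by rewrite e; field.
by field; rewrite t2n.
Qed.

End GaussianIntegrals.

(** Measurability in the pair of outcome and mixing variable, as Tonelli's theorem requires.
    Positivity of [s] allows the explicit formula of the density. *)
Lemma measurable_normal_pdf_joint {d : measure_display} {T : measurableType d}
  {R : realType} (W m s : T -> R) :
  measurable_fun setT W -> measurable_fun setT m -> measurable_fun setT s ->
  (forall w, 0 < s w)%R ->
  measurable_fun setT (fun z : T * R => W z.1 * normal_pdf (m z.1) (s z.1) z.2)%R.
Proof.
move=> mW mm ms s0.
have -> : (fun z : T * R => W z.1 * normal_pdf (m z.1) (s z.1) z.2)%R =
  (fun z => W z.1 * ((Num.sqrt (s z.1 ^+ 2 * pi *+ 2))^-1 *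
    expR (- (z.2 - m z.1) ^+ 2 * (s z.1 ^+ 2 *+ 2)^-1)))%R.
  by apply/funext => z; rewrite normal_pdf_expR// gt_eqF.
have fst_m (f : T -> R) : measurable_fun setT f ->
    measurable_fun setT (fun z : T * R => f z.1).
  by move=> mf; exact: measurableT_comp.
have s2 (z : T * R) : (0 < s z.1 ^+ 2)%R by rewrite exprn_gt0.
have ms2 : measurable_fun setT (fun z : T * R => s z.1 ^+ 2)%R.
  by apply: measurable_funX; exact: fst_m.
have muln2 (f : T * R -> R) : measurable_fun setT f ->
    measurable_fun setT (fun z => f z *+ 2)%R.
  by move=> mf; under eq_fun do rewrite mulr2n; exact: measurable_funD.
apply: measurable_funM; first exact: fst_m.
apply: measurable_funM.
  apply: measurable_funV_gt0.
    by move=> z; rewrite sqrtr_gt0 pmulrn_lgt0// mulr_gt0// pi_gt0.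
  apply: measurable_fun_sqrt; apply: muln2; exact: measurable_funM.
apply: (measurableT_comp (@measurable_expR R)); apply: measurable_funM.
  apply: measurable_funN; apply: measurable_funX; apply: measurable_funB => //.
  exact: fst_m.
apply: measurable_funV_gt0; last exact: muln2.
by move=> z; rewrite pmulrn_lgt0.
Qed.

Section SubgaussianQuadratic.
Context {disp : measure_display} {Omega : measurableType disp} {R : realType}.
Context (P : probability Omega R) (gs : set (set Omega)).
Hypothesis sub_gs : <<s gs>> `<=` @measurable _ Omega.
Local Notation OmegaG := (g_sigma_algebraType gs).
Local Notation mu := (@lebesgue_measure R).
Local Open Scope ereal_scope.

(* Writing exp (m eta + s^2 eta^2 / 2) as a Gaussian mixture of exp (x eta) and
   exchanging integrals reduces the claim to constant x, where the weight
   W(w) * normal_pdf (m w) (s w) x depends on the past only. *)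
Lemma subgaussian_quadratic (sigma : R) (eta : Omega -> R) (W m s : OmegaG -> R) :
  measurable_fun setT eta ->
  (forall x A, <<s gs>> A -> \int[P]_(w in A) (expR (x * eta w))%:E <=
     (expR (x ^+ 2 * sigma ^+ 2 / 2))%:E * P A) ->
  measurable_fun setT W -> measurable_fun setT m -> measurable_fun setT s ->
  (forall w, 0 <= W w)%R -> (forall w, 0 < s w)%R ->
  (forall w, s w ^+ 2 * sigma ^+ 2 < 1)%R ->
  \int[P]_w (W w * expR (m w * eta w + s w ^+ 2 * eta w ^+ 2 / 2))%:E <=
  \int[P]_w (W w * ((Num.sqrt (1 - s w ^+ 2 * sigma ^+ 2))^-1 *
    expR (m w ^+ 2 * sigma ^+ 2 / (2 * (1 - s w ^+ 2 * sigma ^+ 2)))))%:E.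
Proof.
move=> meta H mW mm ms W0 s0 s1.
pose phi (z : Omega * R) : R := (W z.1 * normal_pdf (m z.1) (s z.1) z.2)%R.
have mphi : measurable_fun setT phi.
  by apply: measurable_normal_pdf_joint => //; exact: measurable_fun_sub.
have phi0 z : (0 <= phi z)%R by rewrite mulr_ge0// normal_pdf_ge0.
have mixl w : (W w * expR (m w * eta w + s w ^+ 2 * eta w ^+ 2 / 2))%:E =
    \int[mu]_x (phi (w, x) * expR (x * eta w))%:E.
  rewrite EFinM -integral_normal_expR ?gt_eqF// -ge0_integralZl_EFin//.
  - by apply: eq_integral => x _; rewrite -EFinM mulrA.
  - by move=> x _; rewrite lee_fin mulr_ge0 ?expR_ge0 ?normal_pdf_ge0.
  - apply/measurable_EFinP; apply: measurable_funM.
      exact: measurable_normal_pdf.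
    apply: (measurableT_comp (@measurable_expR R)).
    by apply: measurable_funM.
have mixr w : (W w * ((Num.sqrt (1 - s w ^+ 2 * sigma ^+ 2))^-1 *
    expR (m w ^+ 2 * sigma ^+ 2 / (2 * (1 - s w ^+ 2 * sigma ^+ 2)))))%:E =
    \int[mu]_x (phi (w, x) * expR (x ^+ 2 * sigma ^+ 2 / 2))%:E.
  rewrite EFinM -integral_normal_expR_sqr ?gt_eqF// -ge0_integralZl_EFin//.
  - by apply: eq_integral => x _; rewrite -EFinM mulrA.
  - by move=> x _; rewrite lee_fin mulr_ge0 ?expR_ge0 ?normal_pdf_ge0.
  - apply/measurable_EFinP; apply: measurable_funM.
      exact: measurable_normal_pdf.
    apply: (measurableT_comp (@measurable_expR R)).
    by apply: measurable_funM => //; apply: measurable_funM => //; exact: measurable_funX.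
have mexpl : measurable_fun setT (fun z : Omega * R => expR (z.2 * eta z.1)).
  apply: (measurableT_comp (@measurable_expR R)); apply: measurable_funM => //.
  exact: measurableT_comp.
have mexpr : measurable_fun setT (fun z : Omega * R => expR (z.2 ^+ 2 * sigma ^+ 2 / 2)).
  apply: (measurableT_comp (@measurable_expR R)).
  by apply: measurable_funM => //; apply: measurable_funM => //; exact: measurable_funX.
have swap (f : Omega * R -> R) : measurable_fun setT f -> (forall z, 0 <= f z)%R ->
    \int[P]_w \int[mu]_x (f (w, x))%:E = \int[mu]_x \int[P]_w (f (w, x))%:E.
  move=> mf f0; apply: (@fubini_tonelli _ _ _ _ _ P mu (EFin \o f)) => //=.
  exact/measurable_EFinP.
pose F z := (phi z * expR (z.2 * eta z.1))%R.
pose G z := (phi z * expR (z.2 ^+ 2 * sigma ^+ 2 / 2))%R.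
have mF : measurable_fun setT F by exact: measurable_funM.
have mG : measurable_fun setT G by exact: measurable_funM.
have F0 z : (0 <= F z)%R by rewrite mulr_ge0 ?expR_ge0.
have G0 z : (0 <= G z)%R by rewrite mulr_ge0 ?expR_ge0.
have eF : \int[P]_w (W w * expR (m w * eta w + s w ^+ 2 * eta w ^+ 2 / 2))%:E =
    \int[mu]_x \int[P]_w (F (w, x))%:E.
  transitivity (\int[P]_w \int[mu]_x (F (w, x))%:E); last exact: swap.
  by apply: eq_integral => w _; rewrite mixl.
have eG : \int[P]_w (W w * ((Num.sqrt (1 - s w ^+ 2 * sigma ^+ 2))^-1 *
    expR (m w ^+ 2 * sigma ^+ 2 / (2 * (1 - s w ^+ 2 * sigma ^+ 2)))))%:E =
    \int[mu]_x \int[P]_w (G (w, x))%:E.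
  transitivity (\int[P]_w \int[mu]_x (G (w, x))%:E); last exact: swap.
  by apply: eq_integral => w _; rewrite mixr.
rewrite eF eG {eF eG mixl mixr swap}.
apply: ge0_le_integral => //=.
- by move=> x _; apply: integral_ge0 => w _; rewrite lee_fin.
- by apply: (measurable_fun_fubini_tonelli_G (m1 := P) (EFin \o F)) => //=;
    exact/measurable_EFinP.
- by apply: (measurable_fun_fubini_tonelli_G (m1 := P) (EFin \o G)) => //=;
    exact/measurable_EFinP.
move=> x _; rewrite /F /G /=.
(* With [x] fixed, the weight must be measurable for the past and not only for the full
   sigma-algebra. *)
have mphix : measurable_fun setT (fun w : OmegaG => phi (w, x)).
  apply: (measurableT_comp (measurable_normal_pdf_joint mW mm ms s0)).
  exact: measurable_fun_pair.
under [leRHS]eq_integral do rewrite mulrC EFinM.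
rewrite ge0_integralZl_EFin ?expR_ge0//; last 2 first.
- by move=> w _; rewrite lee_fin.
- by apply/measurable_EFinP; exact: (@measurable_fun_sub _ _ _ sub_gs _ _ (fun w => phi (w, x)) mphix).
apply: (weighted_integral_le sub_gs) => //.
- by apply: (measurableT_comp (@measurable_expR R)); exact: measurable_funM.
- by move=> A GA; exact: H.
Qed.

End SubgaussianQuadratic.

(** * Entrywise measurability of matrix-valued maps *)

Section MeasurableMatrices.
Context {disp : measure_display} {T : measurableType disp} {R : realType}.

Definition mx_measurable {m n} (F : T -> 'M[R]_(m, n)) : Prop :=
  forall i j, measurable_fun setT (fun w => F w i j).

Lemma mx_measurable_cst m n (A : 'M[R]_(m, n)) : mx_measurable (fun=> A).
Proof. by move=> i j. Qed.

Lemma mx_measurableD m n (F G : T -> 'M[R]_(m, n)) :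
  mx_measurable F -> mx_measurable G -> mx_measurable (fun w => F w + G w).
Proof.
by move=> mF mG i j; under eq_fun do rewrite mxE; exact: measurable_funD.
Qed.

Lemma mx_measurableZ m n (a : T -> R) (F : T -> 'M[R]_(m, n)) :
  measurable_fun setT a -> mx_measurable F -> mx_measurable (fun w => a w *: F w).
Proof.
by move=> ma mF i j; under eq_fun do rewrite mxE; exact: measurable_funM.
Qed.

Lemma mx_measurable_tr m n (F : T -> 'M[R]_(m, n)) :
  mx_measurable F -> mx_measurable (fun w => (F w)^T).
Proof. by move=> mF i j; under eq_fun do rewrite mxE; exact: mF. Qed.

Lemma mx_measurableM m n p (F : T -> 'M[R]_(m, n)) (G : T -> 'M[R]_(n, p)) :
  mx_measurable F -> mx_measurable G -> mx_measurable (fun w => F w *m G w).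
Proof.
move=> mF mG i j; under eq_fun do rewrite mxE.
by apply: measurable_sum => k; exact: measurable_funM.
Qed.

Lemma measurable_det n (F : T -> 'M[R]_n) :
  mx_measurable F -> measurable_fun setT (fun w => \det (F w)).
Proof.
move=> mF; apply: measurable_sum => s; apply: measurable_funM => //.
by apply: measurable_prod => i _.
Qed.

(** By Cramer's rule the entries are polynomials in those of [F], divided by the determinant. *)
Lemma mx_measurable_inv n (F : T -> 'M[R]_n) : (forall w, 0 < \det (F w)) ->
  mx_measurable F -> mx_measurable (fun w => invmx (F w)).
Proof.
move=> F0 mF; have -> : (fun w => invmx (F w)) =
    (fun w => (\det (F w))^-1 *: \adj (F w)).
  by apply/funext => w; rewrite /invmx unitmxE unitfE gt_eqF.
apply: mx_measurableZ.
  by apply: measurable_funV_gt0 => //; exact: measurable_det.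
move=> i j; under eq_fun do rewrite mxE.
apply: measurable_funM => //; apply: measurable_det => k l.
by under eq_fun do rewrite !mxE; exact: mF.
Qed.

Lemma measurable_bform n (F : T -> 'M[R]_n) (x y : T -> 'cV[R]_n) :
  mx_measurable F -> mx_measurable x -> mx_measurable y ->
  measurable_fun setT (fun w => bform (F w) (x w) (y w)).
Proof.
move=> mF mx my; rewrite /bform.
by apply: mx_measurableM => //; apply: mx_measurableM => //; exact: mx_measurable_tr.
Qed.

Lemma mx_measurable_sum m n (r : seq nat) (F : nat -> T -> 'M[R]_(m, n)) :
  (forall k, k \in r -> mx_measurable (F k)) ->
  mx_measurable (fun w => \sum_(k <- r) F k w).
Proof.
elim: r => [|k r IH] mF.
  by under eq_fun do rewrite big_nil; exact: mx_measurable_cst.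
under eq_fun do rewrite big_cons; apply: mx_measurableD.
  by apply: mF; rewrite mem_head.
by apply: IH => j jr; apply: mF; rewrite in_cons jr orbT.
Qed.

End MeasurableMatrices.

(** * Maximal inequality for nonnegative supermartingales *)

Section Ville.
Context {disp : measure_display} {Omega : measurableType disp} {R : realType}.
Context (P : probability Omega R).
Local Open Scope ereal_scope.

Lemma probability_bigcap_ge (p : \bar R) (E : (set Omega)^nat) :
  (forall n, measurable (E n)) -> nonincreasing_seq E ->
  (forall n, p <= P (E n)) -> p <= P (\bigcap_n E n).
Proof.
move=> mE ndE pE.
have cvE : P \o E @ \oo --> P (\bigcap_n E n).
  apply: nonincreasing_cvg_mu => //; last exact: bigcapT_measurable.
  by rewrite (le_lt_trans (probability_le1 P (mE 0%N))) ?ltry.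
rewrite -(cvg_lim _ cvE)//; apply: lime_ge; last exact: nearW.
by apply/cvg_ex; exists (P (\bigcap_n E n)).
Qed.

Lemma ville_inequality (gs : nat -> set (set Omega)) (Z : nat -> Omega -> R)
    (c : R) :
  (forall n, <<s gs n>> `<=` @measurable _ Omega) ->
  (forall n, <<s gs n>> `<=` <<s gs n.+1>>) ->
  (forall n, measurable_fun setT (Z n : g_sigma_algebraType (gs n) -> R)) ->
  (forall n w, 0 <= Z n w)%R -> (forall w, Z 0%N w = 1)%R -> (1 <= c)%R ->
  (forall n A, <<s gs n>> A ->
     \int[P]_(w in A) (Z n.+1 w)%:E <= \int[P]_(w in A) (Z n w)%:E) ->
  (1 - c^-1)%:E <= P [set w | forall n, (Z n w <= c)%R].
Proof.
move=> gsP gsS mZ Z0 Z01 c1 ZS.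
have c0 : (0 < c)%R by exact: lt_le_trans c1.
pose N n := [set w | forall k, (k <= n)%N -> (Z k w <= c)%R].
have gsle m n : (m <= n)%N -> <<s gs m>> `<=` <<s gs n>>.
  elim: n => [|n IH]; first by rewrite leqn0 => /eqP ->.
  rewrite leq_eqVlt => /orP[/eqP -> //|]; rewrite ltnS => /IH mn.
  exact: subset_trans mn (gsS n).
have gZ n : <<s gs n>> [set w | (Z n w <= c)%R].
  have := @measurable_funPTI _ _ (g_sigma_algebraType (gs n)) _.
  rewrite (_ : [set w | _] = Z n @^-1` `]-oo, c]); last first.
    by apply/seteqP; split=> w /=; rewrite in_itv.
  move=> _; rewrite -[X in <<s _ >> X]setTI.
  by apply: (mZ n measurableT); exact: measurable_itv.
have NS n : N n.+1 = N n `&` [set w | (Z n.+1 w <= c)%R].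
  apply/seteqP; split=> [w Nw|w [Nw Zw] k].
    by split=> [k kn|]; apply: Nw => //; exact: leqW.
  by rewrite leq_eqVlt => /orP[/eqP -> //|]; rewrite ltnS => /Nw.
have N0 : N 0%N = setT.
  by apply/seteqP; split=> // w _ k; rewrite leqn0 => /eqP ->; rewrite Z01.
have gN n : <<s gs n>> (N n).
  elim: n => [|n IH]; first by rewrite N0; exact: (@measurableT _ (g_sigma_algebraType _)).
  rewrite NS; apply: (@measurableI _ (g_sigma_algebraType (gs n.+1))); last exact: gZ.
  exact: gsS.
have mN n : measurable (N n) by exact: gsP (gN n).
have mZO n : measurable_fun setT (Z n).
  by apply: measurable_fun_sub (mZ n); exact: gsP.
(* Stopped form of the supermartingale: [N n] is the event of no crossing of [c] up to time [n].
   Outcomes leaving at time [n.+1] have [Z n.+1 > c], so moving them from the integral to the first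
   term does not increase the total. *)
have main n : c%:E * P (~` N n) + \int[P]_(w in N n) (Z n w)%:E <= 1.
  elim: n => [|n IH].
    rewrite N0 setCT measure0 mule0 add0e; under eq_integral do rewrite Z01.
    by rewrite integral_cst// mul1e probability_le1.
  apply: le_trans IH; set D := N n `\` N n.+1.
  have mD : measurable D by exact: measurableD.
  have NE : N n = N n.+1 `|` D.
    by rewrite /D setDUK// NS; exact: subIsetl.
  have -> : ~` N n.+1 = ~` N n `|` D.
    apply/seteqP; split=> [w nw|w [nw|[_]]//].
      by have [Nw|nNw] := pselect (N n w); [right; split|left].
    by rewrite /setC/= NS => -[].
  rewrite measureU//; last 2 first.
  - exact: measurableC.
  - by apply/seteqP; split=> // w [Nw []].
  apply: le_trans (_ : c%:E * P (~` N n) + \int[P]_(w in N n) (Z n.+1 w)%:E <= _).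
    rewrite ge0_muleDr// -addeA leeD2l//.
    rewrite [in leRHS]NE ge0_integral_setU//; last 3 first.
    - by apply: measurable_funTS; exact/measurable_EFinP.
    - by move=> w _; rewrite lee_fin.
    - by apply/disj_set2P/seteqP; split=> // w [+ []].
    rewrite addeC leeD2l// -integral_cst//; apply: ge0_le_integral => //.
    - by move=> w _; rewrite lee_fin ltW.
    - by apply: measurable_funTS; exact/measurable_EFinP.
    - move=> w [Nw nNw]; rewrite lee_fin leNgt; apply/negP => Zc.
      by apply: nNw; rewrite NS; split=> //=; exact: ltW.
  by rewrite leeD2l//; apply: ZS.
have -> : [set w | forall n, (Z n w <= c)%R] = \bigcap_n N n.
  by apply/seteqP; split=> [w Zw n _ k _ //|w Nw n]; apply: (Nw n).
apply: probability_bigcap_ge => //.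
  apply/nonincreasing_seqP => n; apply/subsetPset; rewrite NS; exact: subIsetl.
move=> n; have := main n.
have : 0 <= \int[P]_(w in N n) (Z n w)%:E.
  by apply: integral_ge0 => w _; rewrite lee_fin.
have -> : P (N n) = 1 - P (~` N n).
  by rewrite -(probability_setC P (measurableC (mN n))) setCK.
move=> I0 /(le_trans (leeDl _ I0)).
rewrite -(fineK (fin_num_measure P (~` N n) (measurableC (mN n)))).
rewrite -EFinM -EFinB !lee_fin => h; rewrite lerD2l lerN2.
by rewrite -[leRHS]mul1r ler_pdivlMr// mulrC.
Qed.

End Ville.

(** * Self-normalized concentration *)

Section SelfNormalized.
Context {disp : measure_display} {Omega : measurableType disp} {R : realType}.
Context (P : probability Omega R) {d : nat}.
Context (gs : nat -> set (set Omega)) (x : nat -> Omega -> 'cV[R]_d).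
Context (eta : nat -> Omega -> R) (lambda : R).
Local Notation OmegaG n := (g_sigma_algebraType (gs n)).

Hypothesis gsP : forall n, <<s gs n>> `<=` @measurable _ Omega.
Hypothesis gsS : forall n, <<s gs n>> `<=` <<s gs n.+1>>.
Hypothesis lambda_gt0 : 0 < lambda.
Hypothesis meta : forall n, measurable_fun setT (eta n.+1).
(** Index convention: [gs n] is the information available just before [eta n.+1] is revealed, so
    [x n.+1] is already known. The next hypothesis concerns the product only, because the noise of
    an unqueried round is never observed, whereas its vector will be zero. *)
Hypothesis mx : forall n, mx_measurable (x n.+1 : OmegaG n -> _).
Hypothesis mxe : forall n,
  mx_measurable (fun w : OmegaG n.+1 => eta n.+1 w *: x n.+1 w).

Definition noise_sum (n : nat) (w : Omega) : 'cV[R]_d :=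
  \sum_(1 <= k < n.+1) eta k w *: x k w.

Let V n w := design lambda (x ^~ w) n.
Let Y n w := bform (invmx (V n w)) (noise_sum n w) (noise_sum n w).

Lemma mx_measurable_le m n p q (F : Omega -> 'M[R]_(p, q)) : (m <= n)%N ->
  mx_measurable (F : OmegaG m -> _) -> mx_measurable (F : OmegaG n -> _).
Proof.
move=> mn mF i j.
have gsmn : <<s gs m>> `<=` @measurable _ (OmegaG n).
  elim: n mn => [|n IH]; first by rewrite leqn0 => /eqP ->.
  rewrite leq_eqVlt => /orP[/eqP -> //|]; rewrite ltnS => /IH mn.
  exact: subset_trans mn (@gsS n).
exact: (@measurable_fun_sub _ (OmegaG n) _ gsmn _ _ (fun w => F w i j) (mF i j)).
Qed.

Lemma mx_measurable_design n : mx_measurable (V n : OmegaG n -> _).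
Proof.
apply: mx_measurableD; first exact: mx_measurable_cst.
apply: mx_measurable_sum => k; rewrite mem_index_iota => /andP[k0 kn].
have mxk : mx_measurable (x k : OmegaG n -> _).
  by case: k k0 kn => // k _ kn; apply: mx_measurable_le (@mx k); exact: ltnW.
by apply: mx_measurableM => //; exact: mx_measurable_tr.
Qed.

Lemma mx_measurable_noise_sum n : mx_measurable (noise_sum n : OmegaG n -> _).
Proof.
apply: mx_measurable_sum => k; rewrite mem_index_iota => /andP[k0 kn].
by case: k k0 kn => // k _ kn; exact: mx_measurable_le (@mxe k).
Qed.

Lemma mx_measurable_design_inv n :
  mx_measurable ((fun w => invmx (V n w)) : OmegaG n -> _).
Proof.
apply: mx_measurable_inv (@mx_measurable_design n) => w.
exact/posdef_det_gt0/posdef_design.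
Qed.

Lemma measurable_noise_form n : measurable_fun setT (Y n : OmegaG n -> R).
Proof.
apply: measurable_bform; first exact: mx_measurable_design_inv.
  exact: mx_measurable_noise_sum.
exact: mx_measurable_noise_sum.
Qed.

Lemma measurable_log_det_ratio n :
  measurable_fun setT ((fun w => log_det_ratio lambda (x ^~ w) n) : OmegaG n -> R).
Proof.
apply: (measurableT_comp (@measurable_ln R)); apply: measurable_funM => //.
exact: measurable_det (@mx_measurable_design n).
Qed.

Section Supermartingale.
Context (sigma : R).
Hypothesis sigma_gt0 : 0 < sigma.
Hypothesis subgaussian : forall n s A, <<s gs n>> A ->
  (\int[P]_(w in A) (expR (s * eta n.+1 w))%:E <=
   (expR (s ^+ 2 * sigma ^+ 2 / 2))%:E * P A)%E.

(** Closed form of the average of [exp (<u, S_n> - sigma^2 / 2 * sum_k <u, x_k>^2)] over a centred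
    Gaussian [u] with covariance [1 / (lambda * sigma^2)] times the identity; it avoids integrating
    over vectors. *)
Definition mixture (n : nat) (w : Omega) : R :=
  expR ((Y n w / sigma ^+ 2 - log_det_ratio lambda (x ^~ w) n) / 2).

Lemma measurable_mixture n : measurable_fun setT (mixture n : OmegaG n -> R).
Proof.
apply: (measurableT_comp (@measurable_expR R)); apply: measurable_funM => //.
apply: measurable_funB; last exact: measurable_log_det_ratio.
by apply: measurable_funM => //; exact: measurable_noise_form.
Qed.

Lemma mixture0 w : mixture 0 w = 1.
Proof.
rewrite /mixture log_det_ratio0// /Y /noise_sum big_geq// bform0r.
by rewrite mul0r subrr mul0r expR0.
Qed.

(** The rank-one update isolates the dependence on the new noise in the last factor, in the shape
    treated by [subgaussian_quadratic]. *)
Lemma mixtureS n w :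
  let q := bform (invmx (V n w)) (x n.+1 w) (x n.+1 w) in
  let p := bform (invmx (V n w)) (x n.+1 w) (noise_sum n w) in
  mixture n.+1 w =
  mixture n w * expR (- (p ^+ 2 / ((1 + q) * sigma ^+ 2) + ln (1 + q)) / 2)
  * expR (p / ((1 + q) * sigma ^+ 2) * eta n.+1 w
          + q / ((1 + q) * sigma ^+ 2) * eta n.+1 w ^+ 2 / 2).
Proof.
move=> q p; have pV := posdef_design lambda_gt0 (x ^~ w) n.
have q0 : 0 <= q by apply: posdef_ge0; exact: posdef_inv.
rewrite /mixture -!expRD; congr expR; rewrite /Y.
have -> : noise_sum n.+1 w = noise_sum n w + eta n.+1 w *: x n.+1 w.
  by rewrite /noise_sum big_nat_recr.
rewrite /V log_det_ratioS// designS bform_inv_rank1// -/(V n w) -/q -/p.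
by field; rewrite !gt_eqF// ltr_wpDr.
Qed.

(** With [m = p / ((1 + q) * sigma ^+ 2)] and [s ^+ 2 = q / ((1 + q) * sigma ^+ 2)], one has
    [1 - s ^+ 2 * sigma ^+ 2 = (1 + q)^-1]. The bound of [subgaussian_quadratic] is then exactly
    cancelled by the prefactor of [mixtureS]. *)
Lemma mixture_supermartingale n A : <<s gs n>> A ->
  (\int[P]_(w in A) (mixture n.+1 w)%:E <= \int[P]_(w in A) (mixture n w)%:E)%E.
Proof.
move=> GA.
pose q w := bform (invmx (V n w)) (x n.+1 w) (x n.+1 w).
pose p w := bform (invmx (V n w)) (x n.+1 w) (noise_sum n w).
have pV w := posdef_design lambda_gt0 (x ^~ w) n.
have q0 w : 0 <= q w by exact: (posdef_ge0 _ (posdef_inv (pV w))).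
have q1 w : 0 < 1 + q w by rewrite ltr_wpDr.
have mU := @mx_measurable_design_inv n.
have mq : measurable_fun setT (q : OmegaG n -> R) by exact: measurable_bform.
have mp : measurable_fun setT (p : OmegaG n -> R).
  by apply: measurable_bform => //; exact: mx_measurable_noise_sum.
have mq1 : measurable_fun setT ((fun w => (1 + q w)^-1) : OmegaG n -> R).
  by apply: measurable_funV_gt0 => //; exact: measurable_funD.
(* Where [q] vanishes the new vector is zero and the mixture does not move; the Gaussian argument,
   which needs positive variance, is confined to [D]. *)
pose D := q @^-1` `]0, +oo[.
have GD : <<s gs n>> D.
  rewrite -[X in <<s _ >> X]setTI.
  by apply: (mq measurableT); exact: measurable_itv.
have DE w : D w = (0 < q w) :> Prop by rewrite /D /= in_itv /= andbT.
pose AD := A `&` D.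
have GAD : <<s gs n>> AD by exact: (@measurableI _ (OmegaG n)).
have GAnD : <<s gs n>> (A `\` D) by exact: (@measurableD _ (OmegaG n)).
have mM k : measurable_fun setT (mixture k).
  by apply: measurable_fun_sub (@measurable_mixture k); exact: gsP.
have M0 k w : 0 <= mixture k w by exact: expR_ge0.
have split k : (\int[P]_(w in A) (mixture k w)%:E =
    \int[P]_(w in AD) (mixture k w)%:E + \int[P]_(w in A `\` D) (mixture k w)%:E)%E.
  rewrite -ge0_integral_setU//.
  - by rewrite /AD setUIDK.
  - exact: gsP GAD.
  - exact: gsP GAnD.
  - by apply: measurable_funTS; exact/measurable_EFinP.
  - by move=> w _; rewrite lee_fin.
  - by apply/disj_set2P/seteqP; split=> // w [[_ ?] []].
rewrite !split; apply: leeD; last first.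
  rewrite le_eqVlt; apply/orP; left; apply/eqP.
  apply: eq_integral => w; rewrite inE => -[_]; rewrite DE => qw.
  have x0 : x n.+1 w = 0.
    apply/eqP; apply/negPn/negP => /(posdef_inv (pV w)).2; exact: qw.
  congr EFin; rewrite mixtureS x0 bform0r !bform0l expr0n/= !mul0r !addr0 ln1.
  by rewrite addr0 oppr0 mul0r !expR0 !mulr1.
have mu1 (f : Omega -> R) : (\int[P]_(w in AD) (f w)%:E =
    \int[P]_w (\1_AD w * f w)%:E)%E.
  rewrite [LHS]integral_mkcond; apply: eq_integral => w _.
  by rewrite patchE indicE; case: ifPn => _; rewrite ?mul1r ?mul0r.
rewrite !mu1.
pose W w := \1_AD w * (mixture n w *
  expR (- (p w ^+ 2 / ((1 + q w) * sigma ^+ 2) + ln (1 + q w)) / 2)).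
pose m w := p w / ((1 + q w) * sigma ^+ 2).
(* The second summand keeps [s] positive off [D], where the weight [W] is zero; the value
   [(2 * sigma)^-1] gives [s ^+ 2 * sigma ^+ 2 = 1 / 4], below 1 as required. *)
pose s w := Num.sqrt (q w / (1 + q w)) / sigma + \1_(~` D) w * (2 * sigma)^-1.
have sD w : D w -> s w ^+ 2 = q w / ((1 + q w) * sigma ^+ 2).
  move=> Dw; have nD : ~ (~` D) w by apply.
  rewrite /s indicE (memNset nD) mul0r addr0 expr_div_n.
  by rewrite (sqr_sqrtr (divr_ge0 (q0 w) (ltW (q1 w)))) [in RHS]invfM mulrA.
have snD w : ~ D w -> s w = (2 * sigma)^-1.
  move=> Dw; rewrite /s indicE mem_set// mul1r; suff -> : q w = 0.
    by rewrite mul0r sqrtr0 mul0r add0r.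
  by apply/eqP; rewrite eq_le q0 andbT leNgt; apply/negP; rewrite -DE.
have := @subgaussian_quadratic _ _ _ P _ (@gsP n) sigma (eta n.+1) W m s
  (@meta n) (@subgaussian n).
have mW : measurable_fun setT (W : OmegaG n -> R).
  apply: measurable_funM; first exact: measurable_indic.
  apply: measurable_funM; first exact: measurable_mixture.
  apply: (measurableT_comp (@measurable_expR R)); apply: measurable_funM => //.
  apply: measurable_funN; apply: measurable_funD.
    under eq_fun do rewrite invfM mulrA.
    apply: measurable_funM => //; apply: measurable_funM => //.
    exact: measurable_funX.
  by apply: (measurableT_comp (@measurable_ln R)); exact: measurable_funD.
have mm : measurable_fun setT (m : OmegaG n -> R).
  rewrite /m; under eq_fun do rewrite invfM mulrA.
  by apply: measurable_funM => //; exact: measurable_funM.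
have ms : measurable_fun setT (s : OmegaG n -> R).
  apply: measurable_funD; last first.
    apply: measurable_funM => //; apply: measurable_indic.
    exact: (@measurableC _ (OmegaG n)).
  by apply: measurable_funM => //; apply: measurable_fun_sqrt; exact: measurable_funM.
have W0 w : 0 <= W w by rewrite !mulr_ge0 ?expR_ge0.
have s0 w : 0 < s w.
  have [Dw|nDw] := pselect (D w); last by rewrite snD// invr_gt0 mulr_gt0.
  rewrite /s ltr_pwDl//; last by rewrite mulr_ge0// invr_ge0 mulr_ge0// ltW.
  by rewrite divr_gt0// sqrtr_gt0 divr_gt0//; move: Dw; rewrite DE.
have tD w : D w -> 1 - s w ^+ 2 * sigma ^+ 2 = (1 + q w)^-1.
  by move=> Dw; rewrite sD//; field; rewrite !gt_eqF.
have s1 w : s w ^+ 2 * sigma ^+ 2 < 1.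
  rewrite -subr_gt0; have [Dw|nDw] := pselect (D w); first by rewrite tD// invr_gt0.
  rewrite snD//; have -> : (2 * sigma)^-1 ^+ 2 * sigma ^+ 2 = 4^-1.
    by field; rewrite gt_eqF.
  by lra.
move=> /(_ mW mm ms W0 s0 s1).
have -> : (\int[P]_w (\1_AD w * mixture n.+1 w)%:E =
    \int[P]_w (W w * expR (m w * eta n.+1 w + s w ^+ 2 * eta n.+1 w ^+ 2 / 2))%:E)%E.
  apply: eq_integral => w _; rewrite mixtureS -/(q w) -/(p w) -/(m w) /W.
  have [[_ Dw]|nADw] := pselect (AD w); first by rewrite sD// !mulrA.
  by rewrite indicE memNset// !mul0r.
move=> /le_trans; apply; rewrite le_eqVlt; apply/orP; left; apply/eqP.
apply: eq_integral => w _; congr EFin; rewrite /W.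
have [[_ Dw]|nADw] := pselect (AD w); last by rewrite indicE memNset// !mul0r.
rewrite (tD w Dw) (sqrtrV (ltW (q1 w))) invrK.
have -> : Num.sqrt (1 + q w) = expR (ln (1 + q w) / 2).
  rewrite -[X in Num.sqrt X](lnK (q1 w)) -[X in Num.sqrt (expR X)](mulfVK (_ : 2 != 0 :> R))//.
  by rewrite expRM_natr sqrtr_sqr ger0_norm ?expR_ge0.
rewrite -(mulrA (\1_AD w)) -(mulrA (mixture n w)) -!expRD; congr (_ * _).
congr expR.
by rewrite /m; field; rewrite !gt_eqF.
Qed.

(** Ville's inequality at level [delta^-1]; taking logarithms turns the bound on [mixture] into the
    bound on the noise form. *)
Lemma self_normalized_bound_pos (delta : R) : 0 < delta < 1 ->
  ((1 - delta)%:E <= P [set w | forall n, (Y n w <=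
     sigma ^+ 2 * (log_det_ratio lambda (x ^~ w) n + 2 * ln delta^-1))%R])%E.
Proof.
move=> /andP[delta0 delta1].
have := @ville_inequality _ _ _ P gs mixture delta^-1 gsP gsS
  measurable_mixture (fun n w => expR_ge0 _) mixture0.
rewrite invf_ge1// (ltW delta1) invrK => /(_ isT mixture_supermartingale).
congr (_ <= P _)%E; apply/seteqP.
suff ME n w : (mixture n w <= delta^-1) = (Y n w <=
    sigma ^+ 2 * (log_det_ratio lambda (x ^~ w) n + 2 * ln delta^-1)).
  by split=> w h n; move: (h n); rewrite ME.
rewrite -[X in _ <= X]lnK ?posrE ?invr_gt0// /mixture ler_expR ler_pdivrMr//.
by rewrite lerBlDl ler_pdivrMr ?exprn_gt0// (mulrC _ 2) (mulrC (sigma ^+ 2)).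
Qed.

End Supermartingale.

(* The supermartingale needs sigma > 0; sigma = 0 is the limit of sigma + 1/k. *)
Lemma self_normalized_bound (sigma delta : R) : 0 <= sigma -> 0 < delta < 1 ->
  (forall n s A, <<s gs n>> A ->
    (\int[P]_(w in A) (expR (s * eta n.+1 w))%:E <=
     (expR (s ^+ 2 * sigma ^+ 2 / 2))%:E * P A)%E) ->
  with_probability_at_least P (1 - delta) [set w | forall n,
    bform (invmx (design lambda (x ^~ w) n)) (noise_sum n w) (noise_sum n w) <=
    sigma ^+ 2 * (log_det_ratio lambda (x ^~ w) n + 2 * ln delta^-1)].
Proof.
move=> sigma0 delta01 subg.
have ld0 : 0 <= ln delta^-1.
  by rewrite ln_ge0// invf_ge1; case/andP: delta01 => // _ /ltW.
pose B n w := log_det_ratio lambda (x ^~ w) n + 2 * ln delta^-1.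
have B0 n w : 0 <= B n w by rewrite addr_ge0 ?log_det_ratio_ge0// mulr_ge0.
pose e k : R := k.+1%:R^-1.
have e0 k : 0 < e k by rewrite invr_gt0.
pose E k := [set w | forall n, Y n w <= (sigma + e k) ^+ 2 * B n w].
have mE k : measurable (E k).
  have -> : E k = \bigcap_n [set w | Y n w <= (sigma + e k) ^+ 2 * B n w].
    by apply/seteqP; split=> w h n; [move=> _|]; exact: h.
  apply: bigcapT_measurable => n; apply: (@gsP n).
  have mf : measurable_fun setT
      ((fun w => Y n w - (sigma + e k) ^+ 2 * B n w) : OmegaG n -> R).
    apply: measurable_funB; first exact: measurable_noise_form.
    apply: measurable_funM => //; apply: measurable_funD => //.
    exact: measurable_log_det_ratio.
  have := mf measurableT _ (@measurable_itv _ `]-oo, 0%R]%O).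
  rewrite setTI; congr (<<s _ >> _); apply/seteqP.
  by split=> w /=; rewrite in_itv/= subr_le0.
exists (\bigcap_k E k); split.
- exact: bigcapT_measurable.
- move=> w Ew n /=; rewrite -/(V n w) -/(Y n w) -/(B n w).
  rewrite leNgt; apply/negP => BY.
  (* Since [e k <= 1], replacing [sigma] by [sigma + e k] raises the bound by at most [e k * C]; the
     final 1 makes [C] positive. A strict violation would exceed this for some [k] by the
     Archimedean property. *)
  pose C := (2 * sigma + 1) * B n w + 1.
  have C0 : 0 < C by rewrite ltr_wpDl// mulr_ge0// addr_ge0// mulr_ge0.
  have : sigma ^+ 2 * B n w / C < Y n w / C by rewrite ltr_pM2r ?invr_gt0.
  move=> /ltr_add_invr[k]; rewrite -/(e k) ltr_pdivlMr// mulrDl mulfVK ?gt_eqF//.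
  apply/negP; rewrite -leNgt; apply: le_trans (Ew k I n) _.
  have e1 : e k <= 1 by rewrite invf_le1 ?ler1n.
  have e2 : e k * e k <= e k by rewrite ler_piMr// ltW.
  have := ler_wpM2r (B0 n w) e2; rewrite /C sqrrD.
  have := e0 k; have := B0 n w; lra.
apply: probability_bigcap_ge => //.
  apply/nonincreasing_seqP => k; apply/subsetPset => w Ew n.
  apply: le_trans (Ew n) _; rewrite ler_wpM2r// ler_pXn2r// ?nnegrE ?addr_ge0// ?(ltW (e0 _))//.
  by rewrite lerD2l lef_pV2 ?posrE// ler_nat.
move=> k; apply: (@self_normalized_bound_pos (sigma + e k)) => //.
  by rewrite ltr_wpDl.
move=> n s A GA; apply: le_trans (subg n s A GA) _.
rewrite lee_wpmul2r// lee_fin ler_expR ler_wpM2r// ler_wpM2l ?sqr_ge0//.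
by rewrite ler_pXn2r ?nnegrE ?addr_ge0// ?(ltW (e0 _))// lerDl ltW.
Qed.

End SelfNormalized.

(** * The interaction *)

(** The conditional bound holds only almost surely and for a version [Y] that may be negative
    somewhere, so the comparison goes through the positive part of [Y]. *)
Lemma subgaussian_integral_le {disp : measure_display}
    {Omega : measurableType disp} {R : realType} (P : probability Omega R)
    (G : set (set Omega)) (sigma : R) (eta : Omega -> R) (s : R) (A : set Omega) :
  cond_subgaussian P G sigma eta -> G A ->
  (\int[P]_(w in A) (expR (s * eta w))%:E <=
   (expR (s ^+ 2 * sigma ^+ 2 / 2))%:E * P A)%E.
Proof.
move=> /(_ s)[Y [GP _ /measurable_int mY _ YE] Yle] GA; rewrite -YE//.
have mA : measurable A by exact: GP.
have mYA : measurable_fun A (EFin \o Y) by exact: measurable_funTS.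
rewrite -[leRHS]integral_cst//.
have neg0 : (0 <= \int[P]_(w in A) ((EFin \o Y) ^\- w))%E by exact: integral_ge0.
apply: (@le_trans _ _ (\int[P]_(w in A) ((EFin \o Y) ^\+ w))%E).
  by rewrite [leLHS]integralE geeDl// oppe_le0.
apply: ae_ge0_le_integral => //.
- exact: measurable_funepos.
- by move=> w _; rewrite lee_fin expR_ge0.
- apply: filterS Yle => w Yw _.
  by rewrite funeposE ge_max/= !lee_fin Yw expR_ge0.
Qed.

Section HistorySigma.
Context {disp : measure_display} {Omega : measurableType disp} {R : realType}.
Context {P : probability Omega R} {d : nat}.
Variables (I : interaction P d) (theta : 'cV[R]_d).

Definition history_funs (t : nat) : set (Omega -> R) :=
  [set f : Omega -> R | exists2 s : nat, (1 <= s <= t)%N & f = budget I s :> (Omega -> R)]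
  `|` [set f : Omega -> R | exists2 s : nat, (1 <= s <= t)%N &
                 exists i : 'I_d, f = (fun w => action I s w i 0)]
  `|` [set f : Omega -> R | exists2 s : nat, (1 <= s <= t)%N &
                 f = (fun w => (query I s w)%:R)]
  `|` [set f : Omega -> R | exists2 s : nat, (1 <= s < t)%N &
                 f = (fun w => (query I s w)%:R * reward I theta s w)].

(** The shift makes the generated sigma-algebra equal to [history_sigma I theta n.+1], relative to
    which [noise I n.+1] is subgaussian. *)
Definition history_gen (n : nat) : set (set Omega) :=
  [set A | exists2 f, history_funs n.+1 f &
             exists2 S : set R, measurable S & A = f @^-1` S].

Lemma history_genS n : <<s history_gen n>> `<=` <<s history_gen n.+1>>.
Proof.
apply: sub_sigma_algebra2 => A [f hf SA]; exists f => //.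
case: hf => [[[|]|]|].
- by move=> [s /andP[s1 sn] e]; left; left; left; exists s; rewrite // s1 leqW.
- by move=> [s /andP[s1 sn] e]; left; left; right; exists s; rewrite // s1 leqW.
- by move=> [s /andP[s1 sn] e]; left; right; exists s; rewrite // s1 leqW.
- by move=> [s /andP[s1 sn] e]; right; exists s; rewrite // s1 leqW.
Qed.

Lemma measurable_history n (f : Omega -> R) : history_funs n.+1 f ->
  measurable_fun setT (f : g_sigma_algebraType (history_gen n) -> R).
Proof.
by move=> hf _ S mS; rewrite setTI; apply: sub_sigma_algebra; exists f => //; exists S.
Qed.

(** Zero in an unqueried round, so that [gram] becomes a [design] matrix. *)
Definition queried_action (k : nat) (w : Omega) : 'cV[R]_d :=
  (query I k w)%:R *: action I k w.

Lemma measurable_history_action k n (i : 'I_d) : (0 < k <= n.+1)%N ->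
  measurable_fun setT ((fun w => action I k w i 0) :
    g_sigma_algebraType (history_gen n) -> R).
Proof.
move=> kn; apply: measurable_history.
by left; left; right; exists k => //; exists i.
Qed.

Lemma mx_measurable_queried_action k n : (0 < k <= n.+1)%N ->
  mx_measurable (queried_action k : g_sigma_algebraType (history_gen n) -> _).
Proof.
move=> kn; apply: mx_measurableZ.
  by apply: measurable_history; left; right; exists k.
by move=> i j; rewrite ord1; exact: measurable_history_action.
Qed.

(** The noise is not a generator, but times the query indicator it is the observed reward minus the
    mean reward, and [theta] is deterministic. *)
Lemma mx_measurable_queried_noise k n : (0 < k <= n)%N ->
  mx_measurable ((fun w => noise I k w *: queried_action k w) :
    g_sigma_algebraType (history_gen n) -> _).
Proof.
move=> /andP[k0 kn]; have kn1 : (0 < k <= n.+1)%N by rewrite k0 leqW.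
have -> : (fun w => noise I k w *: queried_action k w) =
    (fun w => ((query I k w)%:R * reward I theta k w
      - (query I k w)%:R * dotp (action I k w) theta) *: action I k w).
  apply/funext => w; rewrite /queried_action scalerA; congr (_ *: _).
  by rewrite /reward; ring.
have mq : measurable_fun setT ((fun w => (query I k w)%:R) :
    g_sigma_algebraType (history_gen n) -> R).
  by apply: measurable_history; left; right; exists k.
have ma : mx_measurable (action I k : g_sigma_algebraType (history_gen n) -> _).
  by move=> i j; rewrite ord1; exact: measurable_history_action.
apply: mx_measurableZ => //; apply: measurable_funB.
  by apply: measurable_history; right; exists k; rewrite // k0.
apply: measurable_funM => //.
have -> : (fun w => dotp (action I k w) theta) =
    (fun w => bform 1%:M (action I k w) theta).
  by apply/funext => w; rewrite bform1.
by apply: measurable_bform => //; exact: mx_measurable_cst.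
Qed.

End HistorySigma.

(** * Error of the regularized least-squares estimate *)

Section LeastSquares.
Context {disp : measure_display} {Omega : measurableType disp} {R : realType}.
Context {P : probability Omega R} {d : nat}.
Variables (I : interaction P d) (theta : 'cV[R]_d) (lambda : R).
Hypothesis lambda_gt0 : 0 < lambda.

Lemma gram_design t w :
  gram I lambda t w = design lambda (queried_action I ^~ w) t.
Proof.
rewrite /gram /design; congr (_ + _); rewrite big_mkcond; apply: eq_bigr => k _.
rewrite /queried_action; case: ifP => _; first by rewrite scale1r.
by rewrite scale0r mul0mx.
Qed.

(** The queried outer products sum to [V - lambda%:M], hence the bias term [- lambda *: theta]
    beside the noise. *)
Lemma estimateB t w : estimate I theta lambda t w - theta =
  invmx (gram I lambda t w) *m
    (noise_sum (queried_action I) (fun k => noise I k) t w - lambda *: theta).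
Proof.
have pV := posdef_design lambda_gt0 (queried_action I ^~ w) t.
have uV := posdef_unit pV; rewrite /estimate gram_design.
have -> : \sum_(1 <= k < t.+1 | query I k w) reward I theta k w *: action I k w =
    noise_sum (queried_action I) (fun k => noise I k) t w
    + (design lambda (queried_action I ^~ w) t *m theta - lambda *: theta).
  rewrite /design mulmxDl mul_scalar_mx addrAC subrr add0r mulmx_suml.
  rewrite /noise_sum -big_split /= big_mkcond; apply: eq_bigr => k _.
  rewrite /queried_action; case: ifP => _; last by rewrite !scale0r scaler0 !mul0mx addr0.
  rewrite !scale1r /reward scalerDl addrC; congr (_ + _).
  by rewrite -mulmxA [in RHS](mx11_scalar (_^T *m theta)) mul_mx_scalar.
by rewrite addrCA mulmxDr mulKmx// [LHS]addrC addKr.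
Qed.

End LeastSquares.

Section EllipsoidNorm.
Context {R : realType} {d : nat} (V : 'M[R]_d).
Hypothesis pV : posdef V.
Implicit Types x y : 'cV[R]_d.

Lemma normM_ge0 (M : 'M[R]_d) x : 0 <= normM M x.
Proof. exact: sqrtr_ge0. Qed.

Lemma normM_sqr (M : 'M[R]_d) x : posdef M -> normM M x ^+ 2 = bform M x x.
Proof. by move=> pM; rewrite sqr_sqrtr//; exact: posdef_ge0. Qed.

Lemma normM_invmx x : normM V (invmx V *m x) = normM (invmx V) x.
Proof.
rewrite /normM -/(bform V _ _) -/(bform (invmx V) x x).
by rewrite bform_mul bform_mulr trmx_inv pV.1 mulVmx ?mul1mx// posdef_unit.
Qed.

Lemma normMD M x y : posdef M -> normM M (x + y) <= normM M x + normM M y.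
Proof.
move=> pM; rewrite -(@ler_pXn2r _ 2)// ?nnegrE ?addr_ge0 ?normM_ge0//.
rewrite sqrrD !normM_sqr// bformDl !bformDr (bformC y x pM.1).
suff : bform M x y <= normM M x * normM M y by lra.
apply: le_trans (ler_norm _) _; rewrite -(@ler_pXn2r _ 2)// ?nnegrE ?mulr_ge0 ?normM_ge0//.
by rewrite real_normK ?num_real// exprMn !normM_sqr//; exact: bform_CS.
Qed.

Lemma dotp_le_normM x y : `|dotp x y| <= normM (invmx V) x * normM V y.
Proof.
rewrite -(@ler_pXn2r _ 2)// ?nnegrE ?mulr_ge0 ?normM_ge0//.
rewrite real_normK ?num_real// exprMn !normM_sqr//; last exact: posdef_inv.
by rewrite /dotp -bform1; exact: bform_inv_CS.
Qed.

End EllipsoidNorm.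

(** * Regret of CBM-OFUL *)

Section ConfidenceRadius.
Context {R : realType} (d : nat) (sigma L D lambda delta : R).
Hypotheses (sigma_ge0 : 0 <= sigma) (lambda_gt0 : 0 < lambda)
  (delta01 : 0 < delta < 1).

Lemma l_fun_ge1 t : 1 <= l_fun d sigma L D lambda delta t.
Proof. by rewrite /l_fun le_max lexx. Qed.

Lemma l_fun_le s t : (s <= t)%N ->
  l_fun d sigma L D lambda delta s <= l_fun d sigma L D lambda delta t.
Proof.
move=> st; have /andP[delta0 _] := delta01.
have arg_gt0 n : 0 < (1 + n%:R * L ^+ 2 / lambda) / delta.
  have : 0 <= n%:R * L ^+ 2 / lambda.
    by rewrite divr_ge0 ?(ltW lambda_gt0)// mulr_ge0 ?sqr_ge0.
  by move=> h; rewrite divr_gt0// ltr_wpDr.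
rewrite /l_fun ge_max !le_max lexx /=; apply/orP; right.
rewrite lerD2r ler_wpM2l// ler_wsqrtr// ler_wpM2l ?mulr_ge0//.
rewrite ler_ln ?posrE// ler_pM2r ?invr_gt0// lerD2l ler_pM2r ?invr_gt0//.
by rewrite ler_wpM2r ?sqr_ge0// ler_nat.
Qed.

End ConfidenceRadius.

(** * Deterministic analysis on a fixed outcome *)

Section OneOutcome.
Context {disp : measure_display} {Omega : measurableType disp} {R : realType}.
Context {P : probability Omega R} {d : nat}.
Variables (I : interaction P d) (theta : 'cV[R]_d).
Variables (sigma L D lambda delta : R) (w : Omega).
Hypotheses (d_gt0 : (0 < d)%N) (sigma_ge0 : 0 <= sigma) (L_gt0 : 0 < L)
  (lambda_gt0 : 0 < lambda) (delta01 : 0 < delta < 1) (theta_le : norm2 theta <= D).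
Hypothesis action_le : forall k, (0 < k)%N -> norm2 (action I k w) <= L.

Let l := l_fun d sigma L D lambda delta.
Let v := v_fun d L lambda.
Let x := queried_action I ^~ w.
Let V := gram I lambda ^~ w.
Let count n : R := \sum_(1 <= k < n.+1 | query I k w) 1.

Let pV n : posdef (V n).
Proof. by rewrite /V gram_design; exact: posdef_design. Qed.

Let dR_gt0 : 0 < d%:R :> R. Proof. by rewrite ltr0n. Qed.

Lemma norm2_sqr_le (y : 'cV[R]_d) B : norm2 y <= B -> bform 1%:M y y <= B ^+ 2.
Proof.
move=> yB; have B0 : 0 <= B by apply: le_trans yB; exact: sqrtr_ge0.
have := yB; rewrite -(@ler_pXn2r _ 2)// ?nnegrE ?sqrtr_ge0//.
by rewrite /norm2 /dotp -bform1 sqr_sqrtr// dot_ge0.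
Qed.

Lemma sum_queried_le n :
  \sum_(1 <= k < n.+1) bform 1%:M (x k) (x k) <= count n * L ^+ 2.
Proof.
rewrite /count mulr_suml [leRHS]big_mkcond !big_nat.
apply: ler_sum => k /andP[k0 _]; rewrite /x /queried_action.
case: ifP => _; first by rewrite scale1r mul1r; exact/norm2_sqr_le/action_le.
by rewrite scale0r bform0r.
Qed.

Lemma count_le n : count n <= n%:R.
Proof.
have -> : n%:R = \sum_(1 <= k < n.+1) 1 :> R.
  by rewrite big_const_nat subn1 /= iter_addr_0.
by rewrite /count big_mkcond; apply: ler_sum => k _; case: ifP.
Qed.

Lemma count_ge0 n : 0 <= count n.
Proof. by rewrite /count sumr_ge0. Qed.

(** Stated with the number of queries instead of [n]: [budgeted_sum] needs this sharper form. *)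
Lemma log_det_ratio_count_le n : log_det_ratio lambda x n <=
  d%:R * ln (1 + count n * L ^+ 2 / (d%:R * lambda)).
Proof.
apply: le_trans (log_det_ratio_le lambda_gt0 x n d_gt0) _.
have dl0 : 0 < d%:R * lambda by rewrite mulr_gt0.
rewrite ler_wpM2l// ler_ln ?posrE.
- by rewrite lerD2l ler_pM2r ?invr_gt0// sum_queried_le.
- by rewrite ltr_wpDr// divr_ge0 ?(ltW dl0)// sumr_ge0// => k _; exact: dot_ge0.
- by rewrite ltr_wpDr// divr_ge0 ?(ltW dl0)// mulr_ge0 ?count_ge0 ?sqr_ge0.
Qed.

(** By the triangle inequality the error splits into the noise, controlled by the hypothesis, and
    the bias, which is at most [Num.sqrt lambda * D] by [design_inv_le]. *)
Lemma theta_in_confidence_set n :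
  bform (invmx (design lambda x n))
    (noise_sum (queried_action I) (fun k => noise I k) n w)
    (noise_sum (queried_action I) (fun k => noise I k) n w) <=
    sigma ^+ 2 * (log_det_ratio lambda x n + 2 * ln delta^-1) ->
  confidence_set I theta lambda l n w theta.
Proof.
move=> hS; rewrite /confidence_set /= estimateB// normM_invmx; last exact: pV.
set S := noise_sum _ _ _ _ in hS *.
have pU := posdef_inv (pV n); rewrite -/(V n).
rewrite /l /l_fun le_max; apply/orP; right.
have /andP[delta0 delta1] := delta01.
have ld0 : 0 <= ln delta^-1 by rewrite ln_ge0// invf_ge1// ltW.
apply: le_trans (normMD _ _ pU) _; apply: lerD.
  rewrite -(@ler_pXn2r _ 2)// ?nnegrE ?normM_ge0 ?mulr_ge0 ?sqrtr_ge0//.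
  rewrite normM_sqr// exprMn /V gram_design; apply: le_trans hS _.
  have n0 : 0 <= n%:R * L ^+ 2 / lambda.
    by rewrite divr_ge0 ?mulr_ge0 ?sqr_ge0// ltW.
  rewrite ler_wpM2l ?sqr_ge0// lnM ?posrE ?invr_gt0//; last by rewrite ltr_wpDr.
  have ln0 : 0 <= ln (1 + n%:R * L ^+ 2 / lambda) by rewrite ln_ge0// lerDl.
  rewrite sqr_sqrtr; last by rewrite !mulr_ge0// addr_ge0.
  (* As [d] is at least 1, the term [2 * ln delta^-1] is absorbed into [2 * d%:R * ln delta^-1]. *)
  have d1 : 1 <= d%:R :> R by rewrite ler1n.
  have ldr : log_det_ratio lambda x n <= d%:R * ln (1 + n%:R * L ^+ 2 / lambda).
    apply: le_trans (log_det_ratio_count_le n) _; rewrite ler_wpM2l// ler_ln ?posrE ?ltr_wpDr//.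
      rewrite lerD2l; apply: ler_pM.
      - by rewrite mulr_ge0 ?count_ge0 ?sqr_ge0.
      - by rewrite invr_ge0 mulr_ge0 ?ltW.
      - by rewrite ler_wpM2r ?sqr_ge0 ?count_le.
      - by rewrite lef_pV2 ?posrE ?mulr_gt0// ler_peMl// ltW.
    by rewrite divr_ge0 ?mulr_ge0 ?count_ge0 ?sqr_ge0 ?ler0n// ltW.
  have := ler_wpM2r ld0 d1; have := mulr_ge0 (ltW dR_gt0) ln0; lra.
have D0 : 0 <= D by apply: le_trans theta_le; exact: sqrtr_ge0.
rewrite -(@ler_pXn2r _ 2)// ?nnegrE ?normM_ge0 ?mulr_ge0 ?sqrtr_ge0//.
rewrite normM_sqr// -scaleNr bformZl bformZr mulrA mulrNN exprMn sqr_sqrtr ?(ltW lambda_gt0)//.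
have := design_inv_le lambda_gt0 x n theta; rewrite /V gram_design -/x.
have := norm2_sqr_le theta_le; set N := bform 1%:M _ _; set Q := bform _ _ _ => ND.
rewrite ler_pdivlMr// => QN; rewrite -mulrA ler_pM2l// mulrC.
exact: le_trans ND.
Qed.

Hypothesis follows : follows_CBM_OFUL I theta lambda l v.
Hypothesis contexts_le : forall t y, (0 < t)%N -> contexts I t w y ->
  norm2 y <= L /\ -1 <= dotp y theta <= 1.
Hypothesis theta_mem : forall n, confidence_set I theta lambda l n w theta.

Lemma dotpDr (y u z : 'cV[R]_d) : dotp y (u + z) = dotp y u + dotp y z.
Proof. by rewrite /dotp mulmxDr mxE. Qed.

Lemma dotp_confidence n y th : confidence_set I theta lambda l n w th ->
  `|dotp y (estimate I theta lambda n w) - dotp y th| <= l n * normM (invmx (V n)) y.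
Proof.
rewrite /confidence_set /= => hth.
have -> : dotp y (estimate I theta lambda n w) - dotp y th =
    dotp y (estimate I theta lambda n w - th).
  set e := estimate _ _ _ _ _; have := dotpDr y (e - th) th.
  by rewrite subrK => ->; rewrite addrK.
apply: le_trans (dotp_le_normM (pV n) _ _) _.
by rewrite mulrC ler_wpM2r// normM_ge0.
Qed.

(** One side of the minimum is optimism: the value of any [y] is at most the optimistic value of the
    played action, which exceeds its true value by at most twice [l] times its norm. The other side
    holds because rewards lie in [-1, 1] and [l >= 1]. *)
Lemma instantaneous_regret t : (0 < t)%N ->
  sup [set dotp y theta | y in contexts I t w] - dotp (action I t w) theta
    <= confidence_width I lambda l t w (action I t w).
Proof.
move=> t0; have [[actX opt] _] := follows w t0.
have l1 := l_fun_ge1 d sigma L D lambda delta t.-1.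
have sup_le B : (forall y, contexts I t w y -> dotp y theta <= B) ->
    sup [set dotp y theta | y in contexts I t w] <= B.
  move=> yB; apply: ge_sup; first by exists (dotp (action I t w) theta), (action I t w).
  by move=> _ [y Xy <-]; exact: yB.
have l0 : 0 <= 2 * l t.-1 by rewrite mulr_ge0// (le_trans ler01 l1).
rewrite /confidence_width minr_pMr//.
rewrite le_min; apply/andP; split; rewrite lerBlDr; apply: sup_le => y Xy.
  set a := action I t w in opt actX *; set n := t.-1 in opt *.
  have bnd z c : confidence_set I theta lambda l n w c -> dotp z c <=
      dotp z (estimate I theta lambda n w) + l n * normM (invmx (V n)) z.
    by move=> /(dotp_confidence z); rewrite ler_norml => /andP[]; lra.
  have ub z : dotp z theta <= optimistic_value I theta lambda l n w z.
    apply: ub_le_sup; last by exists theta.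
    by exists (dotp z (estimate I theta lambda n w) + l n * normM (invmx (V n)) z)
      => _ [c Cc <-]; exact: bnd.
  have le_opt : optimistic_value I theta lambda l n w a <=
      dotp a (estimate I theta lambda n w) + l n * normM (invmx (V n)) a.
    apply: ge_sup; first by exists (dotp a theta), theta.
    by move=> _ [c Cc <-]; exact: bnd.
  have := dotp_confidence a (theta_mem n); rewrite ler_norml => /andP[_].
  have := ub y; have := opt _ Xy; rewrite -/(V n); lra.
have [_ /andP[_ y1]] := contexts_le t0 Xy.
have [_ /andP[a1 _]] := contexts_le t0 actX.
rewrite -/l in l1; lra.
Qed.

Hypothesis budget_gt0 : forall t, (0 < t)%N -> 0 < budget I t w.

Lemma regret_bound T : regret I theta T w <= 2 * l T * v T%:R *
  (\sum_(1 <= t < T.+1) (Num.sqrt (budget I t w))^-1 + Num.sqrt T%:R).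
Proof.
have l0 t : 0 < l t by exact: lt_le_trans (l_fun_ge1 _ _ _ _ _ _ _).
pose a t := Num.min (normM (invmx (V t.-1)) (action I t w)) 1.
have a0 t : 0 <= a t by rewrite le_min normM_ge0 ler01.
have vE b : v b = Num.sqrt (2 * d%:R * ln (1 + b * (L ^+ 2 / (d%:R * lambda)))).
  by rewrite /v /v_fun mulrA.
(* The radius [l t.-1] of each round is at most [l T], so it leaves the sum. *)
apply: (@le_trans _ _ (2 * l T * \sum_(1 <= t < T.+1) a t)).
  rewrite /regret mulr_sumr !big_nat; apply: ler_sum => t /andP[t0 tT].
  apply: le_trans (instantaneous_regret t0) _.
  rewrite /confidence_width -/(V t.-1) -/(a t) ler_wpM2r// ler_pM2l//.
  by apply: l_fun_le => //; rewrite (leq_trans (leq_pred t)).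
rewrite -[leRHS]mulrA ler_pM2l; last by rewrite mulr_gt0.
have := @budgeted_sum _ (2 * d%:R) (L ^+ 2 / (d%:R * lambda)) _ _ T
  (fun t => query I t w) a (fun t => budget I t w).
rewrite vE; apply.
- by rewrite mulr_ge0.
- by rewrite divr_gt0 ?exprn_gt0 ?mulr_gt0.
- by move=> t /andP[t0 _]; exact: budget_gt0.
(* The factor [2 * l t.-1] is common to both sides of the failed query condition and cancels. *)
- move=> t /andP[t0 _] nq; have [_ qE] := follows w t0.
  move: nq; rewrite qE /query_condition -ltNge /confidence_width -/(V t.-1) -/(a t).
  by rewrite -vE -[ltRHS]mulrA ltr_pM2l ?mulr_gt0// => /ltW.
rewrite -/(count T) -vE.
have -> : v (count T) ^+ 2 = 2 * (d%:R * ln (1 + count T * L ^+ 2 / (d%:R * lambda))).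
  rewrite /v /v_fun sqr_sqrtr ?mulrA// !mulr_ge0// ln_ge0// lerDl.
  by rewrite divr_ge0 ?mulr_ge0 ?count_ge0 ?sqr_ge0// ltW.
apply: (@le_trans _ _ (2 * log_det_ratio lambda x T)); last first.
  by rewrite ler_pM2l// log_det_ratio_count_le.
apply: le_trans (elliptical_potential lambda_gt0 x T).
(* Unqueried rounds contribute zero to the potential; on queried ones the square of the truncated
   norm is at most the truncated square. *)
rewrite big_mkcond; apply: ler_sum => t _; rewrite {2 3}/x /queried_action.
have pU := posdef_inv (pV t.-1).
case: ifP => _; last by rewrite scale0r bform0r le_min lexx ler01.
rewrite scale1r -gram_design -/(V t.-1) le_min; apply/andP; split.
  rewrite -normM_sqr// ler_pXn2r ?nnegrE ?normM_ge0//.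
  by rewrite /a ge_min lexx.
by rewrite expr_le1// /a ge_min lexx orbT.
Qed.

End OneOutcome.

Theorem theorem3
    (R : realType) (disp : measure_display) (Omega : measurableType disp)
    (P : probability Omega R) (d : nat) (sigma L D lambda delta : R)
    (theta : 'cV[R]_d) (I : interaction P d)
    (adv : seq (round R d) -> R * set 'cV[R]_d) :
  let l := l_fun d sigma L D lambda delta in
  let v := v_fun d L lambda in
  (0 < d)%N -> 0 <= sigma -> 0 < L -> 0 < D -> 0 < lambda ->
  0 < delta < 1 ->
  norm2 theta <= D ->
  chosen_by_adversary I theta adv ->
  (forall t w, (1 <= t)%N -> budget I t w <= budget I t.+1 w) ->
  (forall t w x, (1 <= t)%N -> contexts I t w x ->
     norm2 x <= L /\ -1 <= dotp x theta <= 1) ->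
  (forall t, (1 <= t)%N ->
     cond_zero_mean P (history_sigma I theta t) (noise I t) /\
     cond_subgaussian P (history_sigma I theta t) sigma (noise I t)) ->
  follows_CBM_OFUL I theta lambda l v ->
  (forall w, 0 < budget I 1%N w) ->
  (forall w, query_condition I lambda l v 1%N w) ->
  with_probability_at_least P (1 - delta)
    [set w | forall T : nat, (1 <= T)%N ->
       regret I theta T w <=
         2 * l T * v T%:R *
           (\sum_(1 <= t < T.+1) (Num.sqrt (budget I t w))^-1 + Num.sqrt T%:R)].
Proof.
move=> l v d_gt0 sigma0 L0 D0 lambda0 delta01 thetaD _ Bmono ctx noiseP follows B1 _.
have budget_gt0 w t : (0 < t)%N -> 0 < budget I t w.
  case: t => // t _; elim: t => [|t IH]; first exact: B1.
  exact: lt_le_trans IH (Bmono _ _ _).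
have action_le w k : (0 < k)%N -> norm2 (action I k w) <= L.
  by move=> k0; have [[/(ctx _ _ _ k0)[]]] := follows k w k0.
have gsP n : <<s history_gen I theta n>> `<=` @measurable _ Omega.
  by have [[]] := noiseP n.+1 isT.
(* A single event serves every round, which makes the final bound uniform in [T]. *)
have [E [mE Eok PE]] : with_probability_at_least P (1 - delta) [set w | forall n,
    bform (invmx (design lambda (queried_action I ^~ w) n))
      (noise_sum (queried_action I) (fun k => noise I k) n w)
      (noise_sum (queried_action I) (fun k => noise I k) n w) <=
    sigma ^+ 2 * (log_det_ratio lambda (queried_action I ^~ w) n + 2 * ln delta^-1)].
  apply: (@self_normalized_bound _ _ _ _ _ (history_gen I theta)) => //.
  - exact: history_genS.
  - by move=> n; apply: mx_measurable_queried_action; rewrite ltnSn.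
  - by move=> n; apply: mx_measurable_queried_noise; rewrite ltnSn.
  - move=> n s A GA; apply: subgaussian_integral_le GA.
    by have [] := noiseP n.+1 isT.
exists E; split=> // w /Eok /= Yw T _.
apply: regret_bound => //.
- exact: action_le.
- by move=> t y; exact: ctx.
- by move=> n; apply: theta_in_confidence_set => //; exact: action_le.
- exact: budget_gt0.
Qed.
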